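(* Let $g_{\tau,r}^{\delta}$ be the exponential-type Tikhonov regularized solution obtained from $\hat h^\delta$, i.e. the solution of $\left(K^*K+\tau\exp((-L)^r)\right)g_{\tau,r}^\delta=K^*\hat h^\delta$. (i) If $r\le 0$ and the exact source term satisfies $g\in D((-L)^p)$ for some $p>0$, then $$\|g_{\tau,r}^{\delta}-g\|\le\begin{cases} C\left(1+\|g\|_{D((-L)^p)}\right)\delta^{\frac23}, & p\ge2,\ \tau=\delta^{\frac23},\\ C\left(1+\|g\|_{D((-L)^p)}\right)\delta^{\frac{p}{p+1}}, & 0<p<2,\ \tau=\delta^{\frac{2}{p+1}}.\end{cases}$$ (ii) If $r>0$ and the exact source term satisfies $g\in D\left(\exp\left(\frac{(-L)^r}{2}\right)\right)$, then taking $\tau=\delta^{\frac{(p+1)(2+r)}{(2+r)+(p+1)}}$ yields $$\|g_{\tau,r}^{\delta}-g\|\le C\left(1+\|g\|_{r,\mathrm{exp}}\right)\delta^{\frac{2+r}{(2+r)+(p+1)}},$$ where $p>1$ is an arbitrary number. Here $C>0$ is a generic constant depending only on $\alpha,\beta,l$ and the operator $L$, but independent of $g$, $\tau$ and $\delta$.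
   Context: Fix $\alpha\in(0,1]$, $\beta\ge 0$, $l>0$, and a bounded connected domain $\Omega\subset\mathbb{R}^N$ ($N\ge1$) with smooth boundary. $(\cdot,\cdot)$ and $\|\cdot\|$ are the inner product and norm of $L^2(\Omega)$. $-L:H^2(\Omega)\cap H_0^1(\Omega)\to L^2(\Omega)$ is a symmetric uniformly elliptic operator with eigenpairs $-L\varphi_k=\lambda_k\varphi_k$, $0<\lambda_1\le\lambda_2\le\cdots\to\infty$, where $\{\varphi_k\}_{k\ge1}$ is a complete orthonormal basis of $L^2(\Omega)$. $\|\psi\|_{D((-L)^s)}=(\sum_k\lambda_k^{2s}|(\psi,\varphi_k)|^2)^{1/2}$ and $\|\psi\|_{r,\mathrm{exp}}=(\sum_k\exp(\lambda_k^r)|(\psi,\varphi_k)|^2)^{1/2}$; $D((-L)^s)$ and $D(\exp(\frac{(-L)^r}{2}))$ are the subspaces of $L^2(\Omega)$ where these norms are finite. $\exp((-L)^r)$ acts by $\exp((-L)^r)\varphi_k=\exp(\lambda_k^r)\varphi_k$. Kilbas–Saigo function: $E_{\alpha,m,n}(z)=1+\sum_{k=1}^\infty\prod_{j=0}^{k-1}\frac{\Gamma(\alpha(jm+n)+1)}{\Gamma(\alpha(jm+n+1)+1)}z^k$ ($\alpha,m>0$, $n>-1/\alpha$). Put $\eta_2=\frac{\Gamma(1+\beta)}{\Gamma(1+\alpha+\beta)}$ and $$\sigma_k=\frac{\eta_2}{\sqrt{\lambda_k}}\,l^{\alpha+\beta}E_{\alpha,1+\frac{\beta}{\alpha},1+\frac{2\beta}{\alpha}}\left(-\sqrt{\lambda_k}\,l^{\alpha+\beta}\right),\qquad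 Kg=\sum_{k=1}^\infty\sigma_k(g,\varphi_k)\varphi_k ;$$ $K^*$ is the adjoint of $K$ in $L^2(\Omega)$ (in fact $K$ is compact and self-adjoint). Let $f$ be the known boundary datum and $F=\sum_k(f,\varphi_k)E_{\alpha,1+\frac{\beta}{\alpha},\frac{\beta}{\alpha}}(-\sqrt{\lambda_k}\,l^{\alpha+\beta})\varphi_k$. The exact source $g$ produces the exact trace $h=F-Kg$ at $x=l$ (i.e. $h=u(l,\cdot)$ for the underlying fractional elliptic boundary value problem); set $\hat h=F-h=Kg$. The noisy trace $h^\delta\in L^2(\Omega)$ satisfies $\|h^\delta-h\|\le\delta$, $\delta>0$, and $\hat h^\delta=F-h^\delta$, so $\|\hat h^\delta-\hat h\|\le\delta$. Explicitly, for $\tau>0$, $r\in\mathbb{R}$, $$g_{\tau,r}^\delta=\sum_{k=1}^\infty\frac{\sigma_k}{\sigma_k^2+\tau\exp(\lambda_k^r)}(\hat h^\delta,\varphi_k)\varphi_k .$$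
   Formalization: The constant C may also depend on r and p (besides α, β, l and L); a C uniform in r and p is impossible: in (ii), g = Mφ_k with M→∞, exact data, δ chosen so that τ = σ_k²/exp(λ_k^r), and p→1 would force 1 ≤ 2Cσ_k for all k, while σ_k→0. *)

(* Defs.v *)
From HB Require Import structures.
From mathcomp Require Import all_boot all_order all_algebra.
From mathcomp Require Import all_classical all_reals all_analysis.

Set Implicit Arguments.
Unset Strict Implicit.
Unset Printing Implicit Defensive.

Import Order.TTheory GRing.Theory Num.Theory.
Import numFieldNormedType.Exports.

Local Open Scope classical_set_scope.
Local Open Scope ring_scope.

HB.instance Definition _ (R : realType) (m n : nat) :=
  @isMeasurable.Build (sigma_display (@open 'M[R]_(m, n))) 'M[R]_(m, n)
    <<s @open 'M[R]_(m, n) >>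
    (@sigma_algebra0 _ setT open) (@sigma_algebraC _ open)
    (@sigma_algebra_bigcup _ setT open).

Section LebesgueMeasure.
Variable R : realType.

Lemma open_measurable_mx m n (U : set 'M[R]_(m, n)) : open U -> measurable U.
Proof. by move=> oU; apply: sub_sigma_algebra. Qed.

Definition pushforward_measure d1 d2 (T1 : measurableType d1)
    (T2 : measurableType d2) (mu : {measure set T1 -> \bar R}) (f : T1 -> T2)
    (mf : measurable_fun setT f) : {measure set T2 -> \bar R} :=
  measure_function_pushforward__canonical__measure_function_Measure mu mf.

Definition cons_pair n (p : n.-tuple (measurableTypeR R) * measurableTypeR R) :
  n.+1.-tuple (measurableTypeR R) := [tuple of p.2 :: p.1].

Lemma measurable_cons_pair n : measurable_fun setT (@cons_pair n).
Proof.
by apply: measurable_cons; [exact: measurable_snd|exact: measurable_fst].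
Qed.

Fixpoint lebesgue_tuple n :
    {measure set (n.-tuple (measurableTypeR R)) -> \bar R} :=
  match n with
  | 0 => @dirac _ (0.-tuple (measurableTypeR R)) [tuple] R
  | n'.+1 => pushforward_measure (lebesgue_tuple n' \x @lebesgue_measure R)%E
               (@measurable_cons_pair n')
  end.

Definition row_of_tuple n (t : n.-tuple (measurableTypeR R)) : 'rV[R]_n :=
  \row_i tnth t i.

Lemma measurable_row_of_tuple n : measurable_fun setT (@row_of_tuple n).
Proof.
apply: (@measurability _ _ _ _ setT (@row_of_tuple n) (@open 'rV[R]_n)) => //.
move=> _ [U oU <-]; rewrite setTI.
pose box (q : {ffun 'I_n -> rat} * rat) : set 'rV[R]_n :=
  [set x | forall i, `|ratr (q.1 i) - x 0 i| < ratr q.2].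
have -> : U = \bigcup_(q in [set q | box q `<=` U]) box q.
  apply/seteqP; split => [x Ux|x [q qU /qU//]].
  have /nbhs_ballP[e /= e0 eU] : nbhs x U by exact: open_nbhs_nbhs.
  have [d de] : {d : rat | 0 < (ratr d : R) < e / 2}.
    apply: cid; have /rat_in_itvoo[d] : 0 < e / 2 by rewrite divr_gt0.
    by rewrite in_itv/=; exists d.
  case/andP: de => d0 de.
  have qP i : {q : rat | x 0 i - ratr d < (ratr q : R) < x 0 i}.
    apply: cid; have /rat_in_itvoo[q] : x 0 i - ratr d < x 0 i.
      by rewrite ltrBlDr ltrDl.
    by rewrite in_itv/=; exists q.
  exists ([ffun i => sval (qP i)], d) => /=; last first.
    move=> i; rewrite ffunE; case: (qP i) => q /= /andP[q1 q2].
    by rewrite ltr0_norm ?subr_lt0// opprB ltrBlDl -ltrBlDr.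
  move=> y ybox; apply: eU; split => // i j; rewrite ord1 {i}.
  rewrite /ball/=; move: (ybox j); rewrite /= ffunE; case: (qP j) => q /=.
  move=> /andP[q1 q2] qy.
  have -> : x 0 j - y 0 j = (x 0 j - ratr q) + (ratr q - y 0 j).
    by rewrite addrA subrK.
  rewrite (le_lt_trans (ler_normD _ _))// (splitr e) ltrD//; last exact: lt_trans de.
  by rewrite gtr0_norm ?subr_gt0// (lt_trans _ de)// ltrBlDl -ltrBlDr.
rewrite preimage_bigcup bigcup_mkcond.
apply: countable_bigcupT_measurable => [|q]; first exact: countableP.
case: ifPn => // _.
have -> : @row_of_tuple n @^-1` box q =
    \bigcap_(i in [set: 'I_n])
      ((fun t => @tnth n (measurableTypeR R) t i) @^-1`
        [set z | `|ratr (q.1 i) - z| < ratr q.2]).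
  apply/seteqP; split => [t bt i _|t bt i] /=.
    by have := bt i; rewrite /= mxE.
  by rewrite mxE; exact: bt.
apply: fin_bigcap_measurable => // i _; rewrite -[X in measurable X]setTI.
apply: measurable_tnth => //.
rewrite (_ : mkset _ = `](ratr (q.1 i) - ratr q.2), (ratr (q.1 i) + ratr q.2)[%classic).
  exact: measurable_itv.
by apply/seteqP; split => z /=; rewrite in_itv/= distrC ltr_distl.
Qed.

Definition lebesgue_rV n : {measure set 'rV[R]_n -> \bar R} :=
  pushforward_measure (lebesgue_tuple n) (@measurable_row_of_tuple n).

Lemma lebesgue_tuple_box n (a b : 'I_n -> R) : (forall i, a i <= b i) ->
  lebesgue_tuple n [set t | forall i, tnth t i \in `[a i, b i]] = (\prod_i (b i - a i))%:E.
Proof.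
elim: n a b => [|n IH] a b ab.
  rewrite /= big_ord0 diracE mem_set//. by move=> [].
rewrite /= /pushforward.
rewrite (_ : _ @^-1` _ = [set t | forall i, tnth t i \in `[a (lift ord0 i), b (lift ord0 i)]] `*` `[a ord0, b ord0]%classic).
  rewrite product_measure1E; last 2 first.
  - rewrite (_ : mkset _ = \bigcap_(i in [set: 'I_n])
      ((fun t => @tnth n (measurableTypeR R) t i) @^-1` `[a (lift ord0 i), b (lift ord0 i)]%classic)).
      apply: fin_bigcap_measurable => // i _; rewrite -[X in measurable X]setTI.
      by apply: measurable_tnth.
    apply/seteqP; split => t H i => [_|]; [exact: H|exact: (H i I)].
  - by [].
  rewrite IH//; rewrite -[X in (_ * X)%E]/(lebesgue_measure `[a ord0, b ord0]) lebesgue_measure_itv /= lte_fin lt_neqAle ab andbT big_ord_recl.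
  case: eqVneq => [->|_]; first by rewrite subrr mul0r mule0.
  by rewrite -EFinB -EFinM mulrC.
apply/seteqP; split => -[t x] /=.
  move=> H; split; last by have := H ord0.
  by move=> i; have := H (lift ord0 i); rewrite tnthS.
by move=> [H1 H2] i; case: (unliftP ord0 i) => [j|] ->; rewrite ?tnthS//; exact: H1.
Qed.

Lemma lebesgue_rV_box n (a b : 'I_n -> R) : (forall i, a i <= b i) ->
  lebesgue_rV n [set x | forall i, x 0 i \in `[a i, b i]] =
  (\prod_i (b i - a i))%:E.
Proof.
move=> ab; rewrite -lebesgue_tuple_box//; congr (lebesgue_tuple n _).
by apply/seteqP; split => t H i; have := H i; rewrite mxE.
Qed.

End LebesgueMeasure.

(* L2 oO is the space of square-integrable representatives: members have type
   'rV[R]_n -> R, only their values on Omega matter, and equality in L^2(Omega)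
   is equality almost everywhere for domain_measure oO. *)
Definition domain_measure (R : realType) n (Omega : set 'rV[R]_n)
    (oO : open Omega) : {measure set 'rV[R]_n -> \bar R} :=
  mrestr (lebesgue_rV R n) (open_measurable_mx oO).

Notation L2 oO := (LfunType (domain_measure oO) (lee1n 2)).

Section Hilbert.
Variables (R : realType) (n : nat) (Omega : set 'rV[R]_n) (oO : open Omega).
Local Notation mu := (domain_measure oO).
Local Notation L2 := (L2 oO).
Implicit Types (u v w : L2) (s : nat -> R) (phi : nat -> L2).

Definition L2dot u v : R := \int[mu]_x (u x * v x).
Definition L2norm u : R := fine ('N[mu]_2[EFin \o u])%E.
Definition L2eq u v : Prop := {ae mu, forall x, u x = v x}.

Definition orthonormal phi := forall i j, L2dot (phi i) (phi j) = (i == j)%:R.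

(* w = \sum_k s_k (u, phi_k) phi_k, with convergence in norm *)
Definition is_spectral_sum phi s u w :=
  (fun m => L2norm (\sum_(k < m) (s k * L2dot u (phi k)) *: phi k - w))
    @ \oo --> 0.

Definition orthonormal_basis phi :=
  orthonormal phi /\ forall u, is_spectral_sum phi (fun=> 1) u u.

Definition is_adjoint (K Kstar : L2 -> L2) :=
  forall u v, L2dot (K u) v = L2dot u (Kstar v).

Definition weighted_normsq phi s u : \bar R :=
  (\sum_(0 <= k <oo) (s k * `|L2dot u (phi k)| ^+ 2)%:E)%E.

Variables (phi : nat -> L2) (lam : nat -> R).

Definition normsq_Dpow (p : R) u := weighted_normsq phi (fun k => lam k `^ (2 * p)) u.
Definition in_Dpow p u : Prop := (normsq_Dpow p u < +oo)%E.
Definition norm_Dpow p u : R := Num.sqrt (fine (normsq_Dpow p u)).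

(* the domain D(exp((-L)^r / 2)) and its norm *)
Definition normsq_exp (r : R) u := weighted_normsq phi (fun k => expR (lam k `^ r)) u.
Definition in_Dexp r u : Prop := (normsq_exp r u < +oo)%E.
Definition norm_exp r u : R := Num.sqrt (fine (normsq_exp r u)).

(* u lies in the domain of exp((-L)^r) and w = exp((-L)^r) u *)
Definition is_exp_powL (r : R) u w :=
  is_spectral_sum phi (fun k => expR (lam k `^ r)) u w.

Definition is_tikhonov_solution (K Kstar : L2 -> L2) (tau r : R) hhat u :=
  exists2 w, is_exp_powL r u w & L2eq (Kstar (K u) + tau *: w) (Kstar hhat).

End Hilbert.

Section Elliptic.
Variables (R : realType) (n : nat).
Local Notation "''e_' i" := (delta_mx 0 i : 'rV[R]_n.+1) (at level 8, i at level 2).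

Fixpoint is_Cn (k : nat) (f : 'rV[R]_n.+1 -> R) : Prop :=
  match k with
  | 0 => continuous f
  | k'.+1 => forall i, (forall x, derivable f x 'e_i) /\ is_Cn k' ('D_('e_i) f)
  end.
Definition smooth f := forall k, is_Cn k f.

(* local defining functions; Omega is meant to be open, so that its boundary is
   closure Omega `\` Omega *)
Definition smooth_boundary (Omega : set 'rV[R]_n.+1) :=
  forall x0, (closure Omega `\` Omega) x0 ->
  exists (rho : 'rV[R]_n.+1 -> R) (U : set 'rV[R]_n.+1),
    [/\ smooth rho, exists i, 'D_('e_i) rho x0 != 0, nbhs x0 U &
        Omega `&` U = [set x | rho x < 0] `&` U].

Variables (Omega : set 'rV[R]_n.+1) (oO : open Omega).
Local Notation mu := (domain_measure oO).
Local Notation L2 := (L2 oO).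

Definition test_function (psi : 'rV[R]_n.+1 -> R) :=
  [/\ smooth psi, compact (closure [set x | psi x != 0]) &
      closure [set x | psi x != 0] `<=` Omega].

Definition is_wpartial (i : 'I_n.+1) (u v : L2) :=
  forall psi, test_function psi ->
    \int[mu]_x (u x * 'D_('e_i) psi x) = - \int[mu]_x (v x * psi x).

Definition H1 (u : L2) := forall i, exists v, is_wpartial i u v.

(* the i-th weak partial derivative, when it exists in L^2(Omega) *)
Definition wpartial (i : 'I_n.+1) (u : L2) : L2 :=
  xget 0 [set v | is_wpartial i u v].

Definition H2 (u : L2) := H1 u /\ forall i, H1 (wpartial i u).

(* closure of the test functions for the norm of H^1(Omega) *)
Definition H10 (u : L2) := H1 u /\
  exists psi : nat -> 'rV[R]_n.+1 -> R,
    [/\ forall m, test_function (psi m),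
        (fun m => 'N[mu]_2[EFin \o (psi m \- u)%R]%E) @ \oo --> 0%E &
        forall i,
        (fun m => 'N[mu]_2[EFin \o ('D_('e_i) (psi m) \- wpartial i u)%R]%E)
          @ \oo --> 0%E].

(* -L u = - \sum_(i, j) a_ij d_i d_j u + \sum_i b_i d_i u + c u, with (a, b, c)
   the second, first and zeroth order coefficients; operators in divergence form
   with a_ij Lipschitz are of this kind *)
Record operator_coefs := OperatorCoefs {
  second_order_coef : 'rV[R]_n.+1 -> 'M[R]_n.+1;
  first_order_coef : 'rV[R]_n.+1 -> 'rV[R]_n.+1;
  zeroth_order_coef : 'rV[R]_n.+1 -> R }.

Definition bounded_measurable (f : 'rV[R]_n.+1 -> R) :=
  measurable_fun Omega f /\ exists M, forall x, Omega x -> `|f x| <= M.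

Definition uniformly_elliptic (A : operator_coefs) :=
  [/\ forall i j, bounded_measurable (fun x => second_order_coef A x i j),
      forall i, bounded_measurable (fun x => first_order_coef A x 0 i),
      bounded_measurable (zeroth_order_coef A),
      forall x, Omega x -> (second_order_coef A x)^T = second_order_coef A x &
      exists2 theta, 0 < theta & forall x (xi : 'rV[R]_n.+1), Omega x ->
        theta * (\sum_i xi 0 i ^+ 2) <=
          \sum_i \sum_j second_order_coef A x i j * xi 0 i * xi 0 j].

Definition negL (A : operator_coefs) (u : L2) (x : 'rV[R]_n.+1) : R :=
  - (\sum_i \sum_j second_order_coef A x i j * wpartial i (wpartial j u) x)
  + \sum_i first_order_coef A x 0 i * wpartial i u x + zeroth_order_coef A x * u x.

Definition dom_negL (u : L2) := H2 u /\ H10 u.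

Definition symmetric_negL (A : operator_coefs) :=
  forall u v, dom_negL u -> dom_negL v ->
    \int[mu]_x (negL A u x * v x) = \int[mu]_x (u x * negL A v x).

(* indexed from 0: phi k and lam k are the (k+1)-st eigenpair *)
Definition eigensystem (A : operator_coefs) (phi : nat -> L2) (lam : nat -> R) :=
  [/\ orthonormal_basis phi,
      forall k, dom_negL (phi k) /\
        {ae mu, forall x, negL A (phi k) x = lam k * phi k x},
      0 < lam 0%N, {homo lam : i j / (i <= j)%N >-> i <= j} &
      lam @ \oo --> +oo].

End Elliptic.

Section KilbasSaigo.
Variable R : realType.

(* Euler's integral, used only for x > 0 *)
Definition Gamma (x : R) : R :=
  \int[lebesgue_measure]_(t in `]0, +oo[) (t `^ (x - 1) * expR (- t)).

Definition kilbas_saigo_coef (alpha m nu : R) (k : nat) : R :=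
  \prod_(j < k) (Gamma (alpha * (j%:R * m + nu) + 1) /
                 Gamma (alpha * (j%:R * m + nu + 1) + 1)).

Definition kilbas_saigo (alpha m nu z : R) : R :=
  1 + limn (series (fun k => kilbas_saigo_coef alpha m nu k.+1 * z ^+ k.+1)).

Variables (alpha beta l : R).

Definition eta2 : R := Gamma (1 + beta) / Gamma (1 + alpha + beta).

Definition sigmaK (lam : nat -> R) (k : nat) : R :=
  eta2 / Num.sqrt (lam k) * l `^ (alpha + beta) *
  kilbas_saigo alpha (1 + beta / alpha) (1 + 2 * beta / alpha)
    (- (Num.sqrt (lam k) * l `^ (alpha + beta))).

Definition boundary_coef (lam : nat -> R) (k : nat) : R :=
  kilbas_saigo alpha (1 + beta / alpha) (beta / alpha)
    (- (Num.sqrt (lam k) * l `^ (alpha + beta))).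

End KilbasSaigo.

(* f: boundary datum; g: exact source; h: exact trace at x = l; hd: noisy trace *)
Record noisy_trace_problem (R : realType) (alpha beta l : R) (n : nat)
    (Omega : set 'rV[R]_n) (oO : open Omega) (phi : nat -> L2 oO)
    (lam : nat -> R) (K Kstar : L2 oO -> L2 oO) (f F g h hd : L2 oO)
    (delta : R) : Prop := NoisyTraceProblem {
  source_to_trace : forall u, is_spectral_sum phi (sigmaK alpha beta l lam) u (K u);
  source_to_trace_adjoint : is_adjoint K Kstar;
  boundary_part : is_spectral_sum phi (boundary_coef alpha beta l lam) f F;
  exact_trace : L2eq h (F - K g);
  noise_level : L2norm (hd - h) <= delta }.

(* Main.v *)
Require Import Defs.
From HB Require Import structures.
From mathcomp Require Import all_boot all_order all_algebra.
From mathcomp Require Import all_classical all_reals all_analysis.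
From mathcomp Require Import measurable_realfun ring lra.

Set Implicit Arguments.
Unset Strict Implicit.
Unset Printing Implicit Defensive.

Import Order.TTheory GRing.Theory Num.Theory.
Import numFieldNormedType.Exports.

Local Open Scope classical_set_scope.
Local Open Scope ring_scope.

(** In the eigenbasis, the k-th coefficient of the error is
    [(sigma_k nu_k - tau e_k g_k) / (sigma_k^2 + tau e_k)] with [nu] the noise and
    [e_k = exp (lam_k^r)]. Writing [y / (x + y) <= (y / x)^s] for [0 <= s <= 1],
    both filter factors are bounded by powers of [tau] using nothing about
    [sigma_k] except a lower bound [sigma_k >= c / lam_k].

    That bound comes from [lam_k sigma_k = 1 - G y], where [y] is a multiple of
    [sqrt lam_k] and [G y = E_{alpha, 1 + beta/alpha, beta/alpha} (- y)]: it
    suffices that [G y <= q < 1] for [y >= y1 > 0]. Up to the factor [1 / k!], the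
    coefficients of [G] are the products of the [j.+1 * gamma_step j], which are
    values of the Bernstein function [Gamma (z + 1) / Gamma (z + alpha)].
    Euler's product approximates it by rational functions [M - v] with [v]
    completely monotone. For these, the products [p] of the values form a sequence
    on which all powers of [M - S], with [S] the shift, are nonnegative; hence
    [(1 - (y / N) S)^N p] decreases in [y] and is at most
    [(1 - y S + y^2 S^2 / 2) p]. Then let [N] and the order of the approximation
    tend to infinity.

    The constant [c] depends on the operator only, because two eigensystems of a
    symmetric operator have the same first eigenvalue. *)

(** * The Gamma function *)

Section PowerExponential.
Variable R : realType.
Local Notation mu := (@lebesgue_measure R).

(** With [u = k * t / s], raise [u <= expR u] to the power [s]; the case [s = 0] is separate because
    of the division. *)
Lemma powR_le_expR (s k : R) : 0 <= s -> 0 < k ->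
  exists2 M, 0 < M & forall t, 0 <= t -> t `^ s <= M * expR (k * t).
Proof.
rewrite le0r => /predU1P[->|s0] k0.
  exists 1 => // t t0; rewrite powRr0 mul1r -expR0 ler_expR.
  by rewrite mulr_ge0// ltW.
have ks0 : 0 < k / s by rewrite divr_gt0.
exists ((k / s) `^ (- s)); first exact: powR_gt0.
move=> t t0; rewrite powRN mulrC ler_pdivlMr ?powR_gt0// -powRM//; last exact: ltW.
apply: (@le_trans _ _ (expR (t * (k / s)) `^ s)).
  rewrite ge0_ler_powR ?nnegrE ?expR_ge0 ?(ltW s0)//; first by rewrite mulr_ge0// ltW.
  by rewrite (le_trans _ (expR_ge1Dx _))// lerDr.
rewrite -expRM ler_expR le_eqVlt; apply/orP; left; apply/eqP.
by have := lt0r_neq0 s0; move=> ?; field.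
Qed.

Lemma powR_continuous_0y (s : R) : 0 <= s ->
  {within `[0, +oo[, continuous (fun t : R => t `^ s)}.
Proof.
move=> s0; apply/continuous_within_itvcyP; split.
  move=> t; rewrite in_itv/= andbT => t0.
  apply: differentiable_continuous; apply/derivable1_diffP.
  by apply: derivable_powR; rewrite in_itv/= t0.
move: s0; rewrite le0r => /predU1P[->|s0].
  rewrite powRr0; under eq_fun do rewrite powRr0; exact: cvg_cst.
by rewrite powR0 ?gt_eqF//; exact: powR_cvg0.
Qed.

Lemma cvg_expRNhalf : expR (- (2^-1 * t)) @[t --> +oo] --> (0 : R).
Proof.
apply: (@cvg_comp _ _ _ (fun t : R => 2^-1 * t) (fun z => expR (- z)) _ +oo).
  exact: gt0_cvgMry.
exact: cvgr_expR.
Qed.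

Lemma is_derive_expRN (k t : R) :
  is_derive t 1 (fun t => expR (- (k * t))) (- k * expR (- (k * t))).
Proof.
have h : is_derive t 1 (fun t : R => - (k * t)) (- k).
  by apply: is_derive_eq; rewrite /GRing.scale/= mulr1.
have := @is_derive1_comp _ expR (fun t : R => - (k * t)) t _ _ (is_derive_expR _) h.
by rewrite mulrC.
Qed.

Lemma is_derive_MexpRN (c k t : R) :
  is_derive t 1 (fun t => c * expR (- (k * t))) (- (c * k) * expR (- (k * t))).
Proof.
have d := is_derive_expRN k t.
have -> : (fun t => c * expR (- (k * t))) = cst c * (fun t => expR (- (k * t))).
  by apply/funext.
by apply: is_derive_eq; rewrite /GRing.scale/= mulrA mulrN mulr0 addr0.
Qed.

Lemma continuous_expRN (k : R) : continuous (fun t : R => expR (- (k * t))).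
Proof.
move=> t; apply: differentiable_continuous; apply/derivable1_diffP.
by have [] := is_derive_expRN k t.
Qed.

Lemma integral_expRNhalf :
  (\int[mu]_(t in `[0%R, +oo[) (expR (- (2^-1 * t)))%:E = 2%:E)%E.
Proof.
rewrite (@ge0_continuous_FTC2y _ _ (fun t => - 2 * expR (- (2^-1 * t))) _ 0)//.
- by rewrite mulr0 oppr0 expR0 mulr1 EFinN oppeK add0e.
- by apply: continuous_subspaceT; exact: continuous_expRN.
- rewrite -[X in _ --> X](mulr0 (- 2)); apply: cvgM; first exact: cvg_cst.
  exact: cvg_expRNhalf.
- apply: cvg_at_right_filter; apply: cvgM; first exact: cvg_cst.
  exact: continuous_expRN.
- move=> x _; rewrite derive1E; have [_ ->] := is_derive_MexpRN (- 2) 2^-1 x.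
  by field.
Qed.

Lemma integrable_expRNhalf :
  mu.-integrable `]0, +oo[ (EFin \o (fun t => expR (- (2^-1 * t)))).
Proof.
suff i : mu.-integrable `[0%R, +oo[ (EFin \o (fun t => expR (- (2^-1 * t)))).
  apply: integrableS i => // t /=.
  by rewrite !in_itv/= !andbT => /ltW.
apply/integrableP; split.
  apply/measurable_EFinP/measurable_funTS; apply: continuous_measurable_fun.
  exact: continuous_expRN.
under eq_integral do rewrite /= ger0_norm ?expR_ge0//.
by rewrite integral_expRNhalf ltry.
Qed.

Lemma measurable_powR_expRN (s : R) :
  measurable_fun [set: R] (fun t : R => t `^ s * expR (- t)).
Proof.
apply: measurable_funM; first exact: measurable_powR.
by apply: continuous_measurable_fun => t;
  have := @continuous_expRN 1 t; under eq_fun do rewrite mul1r.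
Qed.

Lemma integrable_MEFin (f : R -> R) (c : R) :
  mu.-integrable `]0, +oo[ (EFin \o f) ->
  mu.-integrable `]0, +oo[ (EFin \o (fun t => c * f t)).
Proof. by move=> fi; apply: (integrableZl _ c fi). Qed.

(** Half of the exponential decay absorbs the power. The other half remains as a majorant that
    serves both for integrability and for the limit at infinity. *)
Lemma powR_expRN_le (s : R) : 0 <= s -> exists2 M, 0 < M &
  forall t, 0 <= t -> t `^ s * expR (- t) <= M * expR (- (2^-1 * t)).
Proof.
move=> s0; have h0 : 0 < 2^-1 :> R by rewrite invr_gt0.
have [M M0 sM] := powR_le_expR s0 h0.
exists M => // t t0; rewrite (_ : - t = - (2^-1 * t) - 2^-1 * t); last by field.
rewrite expRD mulrA ler_wpM2r ?expR_ge0// expRN ler_pdivrMr ?expR_gt0//.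
exact: sM.
Qed.

Lemma integrable_powR_expRN (s : R) : 0 <= s ->
  mu.-integrable `]0, +oo[ (EFin \o (fun t => t `^ s * expR (- t))).
Proof.
move=> s0; have [M M0 sM] := powR_expRN_le s0.
have iM := integrable_MEFin M integrable_expRNhalf.
apply: le_integrable iM => //.
- apply/measurable_EFinP/measurable_funTS; exact: measurable_powR_expRN.
- move=> t /=; rewrite in_itv/= andbT => t0.
  rewrite lee_fin ger0_norm ?mulr_ge0 ?powR_ge0 ?expR_ge0//.
  by rewrite ger0_norm ?mulr_ge0 ?expR_ge0 ?(ltW M0)// sM// ltW.
Qed.

Lemma cvg_powR_expRN (s : R) : 0 <= s -> t `^ s * expR (- t) @[t --> +oo] --> (0 : R).
Proof.
move=> s0; have [M M0 sM] := powR_expRN_le s0.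
apply: (@squeeze_cvgr _ _ _ _ (fun=> 0) (fun t => M * expR (- (2^-1 * t)))).
- near=> t; rewrite mulr_ge0 ?powR_ge0 ?expR_ge0//=; apply: sM.
  by near: t; exact: nbhs_pinfty_ge.
- exact: cvg_cst.
- rewrite -[X in _ --> X](mulr0 M); apply: cvgM; first exact: cvg_cst.
  exact: cvg_expRNhalf.
Unshelve. all: by end_near. Qed.

End PowerExponential.

(* Gamma is a Lebesgue integral, on which failing unifications are very costly:
   [gammaR] is an opaque copy of it. *)
HB.lock Definition gammaR (R : realType) (x : R) : R := Gamma x.

Section GammaTheory.
Variable R : realType.
Local Notation mu := (@lebesgue_measure R).
Implicit Types x y s d : R.

(* The derivative of [t^x e^(-t)] changes sign; adding a multiple of [e^(-t/2)]
   makes it nonnegative, as the fundamental theorem of calculus on a half-line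
   requires. *)
Lemma gammaRS x : 1 <= x -> gammaR (x + 1) = x * gammaR x.
Proof.
move=> x1; have x0 : 0 <= x by rewrite (le_trans _ x1).
have x10 : 0 <= x - 1 by rewrite subr_ge0.
have [M M0 xM] := powR_expRN_le x0.
pose e t : R := expR (- (2^-1 * t)).
pose a t : R := t `^ (x - 1) * expR (- t).
pose b t : R := t `^ x * expR (- t).
pose f t : R := x * a t - b t + M * e t.
pose F t : R := b t - 2 * M * e t.
have ce : continuous (e : R -> R) by exact: continuous_expRN.
have ce1 : continuous (fun t : R => expR (- t)).
  by move=> t; have := @continuous_expRN _ 1 t; under eq_fun do rewrite mul1r.
have ca s : 0 <= s -> {within `[0, +oo[, continuous (fun t : R => t `^ s * expR (- t))}.
  move=> s0; move=> t; apply: cvgM; first exact: powR_continuous_0y.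
  by apply: continuous_subspaceT; exact: ce1.
have dF (t : R) : 0 < t -> is_derive t 1 F (f t).
  move=> t0; have d1 := is_derive1_powR x t0.
  have d2 := is_derive_expRN 1 t.
  have d3 := is_derive_MexpRN (2 * M) 2^-1 t.
  have -> : F = (fun t => t `^ x) * (fun t => expR (- (1 * t))) -
      (fun t => 2 * M * expR (- (2^-1 * t))).
    by apply/funext => z; rewrite /F /b/= !fctE mul1r.
  apply: is_derive_eq; rewrite /GRing.scale/= !mul1r /f /a /b /e.
  by field.
have FTC : (\int[mu]_(t in `[0%R, +oo[) (f t)%:E = (2 * M)%:E)%E.
  rewrite (@ge0_continuous_FTC2y _ f F _ 0)//.
  - rewrite /F /b /e powR0 ?gt_eqF ?(lt_le_trans _ x1)// mul0r mulr0 oppr0 expR0.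
    by rewrite sub0r mulr1 EFinN oppeK add0e.
  - move=> t t0; rewrite /f addrAC -addrA addr_ge0//.
      by rewrite mulr_ge0// mulr_ge0 ?powR_ge0 ?expR_ge0.
    by rewrite subr_ge0 xM.
  - move=> t; apply: cvgD.
      apply: cvgB; last exact: ca.
      by apply: cvgM; [exact: cvg_cst|exact: ca].
    apply: cvgM; first exact: cvg_cst.
    by apply: continuous_subspaceT; exact: ce.
  - rewrite -[X in _ --> X](subr0 0) -[X in _ - X](mulr0 (2 * M)).
    apply: cvgB; first exact: cvg_powR_expRN.
    by apply: cvgM; [exact: cvg_cst|exact: cvg_expRNhalf].
  - by move=> t /dF[].
  - apply: cvgB.
      by have /continuous_within_itvcyP[_] := ca _ x0.
    apply: cvg_at_right_filter; apply: cvgM; first exact: cvg_cst.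
    exact: ce.
  - by move=> t; rewrite in_itv/= andbT => /dF[_]; rewrite derive1E.
have ia : mu.-integrable `]0, +oo[ (EFin \o (fun t => x * a t)).
  by apply: integrable_MEFin; exact: integrable_powR_expRN.
have ib : mu.-integrable `]0, +oo[ (EFin \o b) by exact: integrable_powR_expRN.
have ie : mu.-integrable `]0, +oo[ (EFin \o e) by exact: integrable_expRNhalf.
have iMe : mu.-integrable `]0, +oo[ (EFin \o (fun t => M * e t)).
  exact: integrable_MEFin.
have iab : mu.-integrable `]0, +oo[ (EFin \o (fun t => x * a t - b t)).
  by apply: (integrableB _ ia ib).
have if_ : mu.-integrable `]0, +oo[ (EFin \o f).
  by apply: (integrableD _ iab iMe).
have : \int[mu]_(t in `]0, +oo[) f t = 2 * M.
  by rewrite Rintegral_itv_obnd_cbnd// /Rintegral FTC.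
have Ie : \int[mu]_(t in `]0, +oo[) e t = 2.
  by rewrite Rintegral_itv_obnd_cbnd// /Rintegral integral_expRNhalf.
rewrite RintegralD// RintegralB// !RintegralZl//; last exact: integrable_powR_expRN.
rewrite Ie => h; rewrite gammaR.unlock /Gamma addrK -/b; lra.
Qed.

Lemma gammaR1 : gammaR 1 = 1 :> R.
Proof.
rewrite gammaR.unlock /Gamma subrr; under eq_Rintegral do rewrite powRr0 mul1r.
have i1 := @integrable_powR_expRN R 0 (lexx _).
rewrite Rintegral_itv_obnd_cbnd; last first.
  by move: i1; congr (_.-integrable _ _); apply/funext => t /=; rewrite powRr0 mul1r.
have ce1 : continuous (fun t : R => expR (- t)).
  by move=> t; have := @continuous_expRN _ 1 t; under eq_fun do rewrite mul1r.
have dF (t : R) : is_derive t 1 (fun t : R => - expR (- t)) (expR (- t)).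
  have -> : (fun t : R => - expR (- t)) = (fun t => -1 * expR (- (1 * t))).
    by apply/funext => z; rewrite mul1r mulN1r.
  by have := is_derive_MexpRN (-1) 1 t; rewrite mulN1r opprK !mul1r.
rewrite (@Rintegral_ge0_continuous_FTC2y _ _ (fun t => - expR (- t)) _ 0)//.
- by rewrite oppr0 expR0 opprK add0r.
- by apply: continuous_subspaceT; exact: ce1.
- by rewrite -oppr0; apply: cvgN; exact: cvgr_expR.
- by apply: cvg_at_right_filter; apply: cvgN; exact: ce1.
- by move=> x _; have [_] := dF x; rewrite derive1E.
Qed.

(** Integrates the pointwise bound [M^s * (t - M) <= t^s * t] against [t^(x - 2) e^(-t)]: the left
    side is nonpositive for [t <= M], and for [t > M] one compares factor by factor. It yields the
    positivity of Gamma and the growth of [gammaR (x + alpha) / gammaR x]. *)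
Lemma gammaR_add_ge x s M : 2 <= x -> 0 <= s -> 0 < M ->
  M `^ s * gammaR x - M `^ (s + 1) * gammaR (x - 1) <= gammaR (x + s).
Proof.
move=> x2 s0 M0; have x20 : 0 <= x - 2 by rewrite subr_ge0.
have i0 y : 1 <= y -> mu.-integrable `]0, +oo[
    (EFin \o (fun t => t `^ (y - 1) * expR (- t))).
  by move=> y1; apply: integrable_powR_expRN; rewrite subr_ge0.
have i1 y c : 1 <= y -> mu.-integrable `]0, +oo[
    (EFin \o (fun t => c * (t `^ (y - 1) * expR (- t)))).
  by move=> y1; apply: integrable_MEFin; exact: i0.
have x1 : 1 <= x by lra.
have x11 : 1 <= x - 1 by lra.
rewrite gammaR.unlock /Gamma -!RintegralZl//; try exact: i0.
rewrite -RintegralB//; try exact: i1.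
apply: le_Rintegral => //.
- by apply: (integrableB _ (i1 _ _ x1) (i1 _ _ x11)).
- by apply: i0; rewrite (le_trans x1)// lerDl.
- move=> t /=; rewrite in_itv/= andbT => t0.
  rewrite !mulrA -mulrBl ler_wpM2r ?expR_ge0//.
  pose w := x - 1 - 1.
  have -> : x + s - 1 = w + 1 + s by rewrite /w; ring.
  have -> : x - 1 = w + 1 by rewrite /w; ring.
  rewrite addrK; clearbody w.
  have t0' := gt_eqF t0; have M0' := gt_eqF M0.
  rewrite !powRD ?t0' ?M0' ?implybT// !powRr1 ?(ltW t0) ?(ltW M0)//.
  rewrite (_ : _ - _ = t `^ w * (M `^ s * (t - M))); last by ring.
  rewrite -mulrA ler_wpM2l ?powR_ge0//.
  have [tM|Mt] := leP t M.
    rewrite (@le_trans _ _ 0)//; last by rewrite mulr_ge0 ?powR_ge0// ltW.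
    by rewrite mulr_ge0_le0 ?powR_ge0// subr_le0.
  rewrite [t * _]mulrC; apply: ler_pM; rewrite ?powR_ge0 ?subr_ge0 ?(ltW Mt)//.
    by rewrite ge0_ler_powR ?nnegrE ?(ltW t0) ?(ltW M0) ?(ltW Mt).
  by rewrite gerBl ltW.
Qed.

Lemma gammaR_gt0 x : 1 <= x -> 0 < gammaR x.
Proof.
move=> x1; have x0 : 0 < x by rewrite (lt_le_trans _ x1).
rewrite -(pmulr_rgt0 _ x0) -gammaRS//.
have h0 : 0 < 2^-1 :> R by rewrite invr_gt0.
have x10 : 0 <= x - 1 by rewrite subr_ge0.
have gammaR2 : gammaR 2 = 1 :> R.
  by rewrite (_ : 2 = 1 + 1)// gammaRS// gammaR1 mulr1.
(* With [M = 1/2] the lower bound for [gammaR (x + 1)] is [M^(x - 1) * (1 - M)], which is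
   positive. *)
have := @gammaR_add_ge 2 (x - 1) 2^-1 (lexx _) x10 h0.
have -> : 2 + (x - 1) = x + 1 by ring.
have -> : (2 : R) - 1 = 1 by ring.
rewrite gammaR2 gammaR1 !mulr1; apply: lt_le_trans.
move: (x - 1) => s; rewrite (@powRD _ 2^-1 s 1) ?(gt_eqF h0) ?implybT// powRr1 ?ltW//.
by rewrite subr_gt0 gtr_pMr ?powR_gt0//; lra.
Qed.

(* Integrate [(t^d - c^d)(t^e - c^e) >= 0], where [c^d = gammaR (x + d) / gammaR x]. *)
Lemma gammaR_ratio_le x y d : 1 <= x <= y -> 0 <= d ->
  gammaR (x + d) * gammaR y <= gammaR x * gammaR (y + d).
Proof.
move=> /andP[x1 xy]; rewrite le0r => /predU1P[->|d0].
  by rewrite !addr0.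
have y1 : 1 <= y by rewrite (le_trans x1).
have xd1 : 1 <= x + d by rewrite ler_wpDr// ltW.
have yd1 : 1 <= y + d by rewrite ler_wpDr// ltW.
have Gx := gammaR_gt0 x1; have Gxd := gammaR_gt0 xd1.
pose q := gammaR (x + d) / gammaR x.
have q0 : 0 < q by rewrite divr_gt0.
pose c := q `^ d^-1.
have c0 : 0 < c by rewrite powR_gt0.
have cd : c `^ d = q by rewrite /c -powRrM mulVf ?gt_eqF// powRr1 ?ltW.
pose e := y - x; have e0 : 0 <= e by rewrite subr_ge0.
have i0 z k : 1 <= z -> mu.-integrable `]0, +oo[
    (EFin \o (fun t => k * (t `^ (z - 1) * expR (- t)))).
  move=> z1; have z10 : 0 <= z - 1 by rewrite subr_ge0.
  by apply: integrable_MEFin; exact: integrable_powR_expRN.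
have i1 z1 z2 k1 k2 : 1 <= z1 -> 1 <= z2 -> mu.-integrable `]0, +oo[
    (EFin \o (fun t => k1 * (t `^ (z1 - 1) * expR (- t)) +
                       k2 * (t `^ (z2 - 1) * expR (- t)))).
  by move=> z11 z21; apply: (integrableD _ (i0 _ _ z11) (i0 _ _ z21)).
have G z k : 1 <= z -> k * gammaR z =
    \int[mu]_(t in `]0, +oo[) (k * (t `^ (z - 1) * expR (- t))).
  move=> z1; rewrite gammaR.unlock RintegralZl//; apply: integrable_powR_expRN.
  by rewrite subr_ge0.
have : c `^ e * gammaR (x + d) + q * gammaR y <= 1 * gammaR (y + d) + q * c `^ e * gammaR x.
  rewrite (G _ _ xd1) (G _ _ y1) (G _ _ yd1) (G _ _ x1) -!RintegralD//; try exact: i0.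
  apply: le_Rintegral => //; try exact: i1.
  move=> t /=; rewrite in_itv/= andbT => t0.
  rewrite !mulrA -!mulrDl ler_wpM2r ?expR_ge0//.
  pose w := x - 1.
  have -> : x + d - 1 = w + d by rewrite /w; ring.
  have -> : y + d - 1 = w + e + d by rewrite /w /e; ring.
  have -> : y - 1 = w + e by rewrite /w /e; ring.
  rewrite -/w; clearbody w e.
  have t0' := gt_eqF t0.
  rewrite !powRD ?t0' ?implybT// mul1r -subr_ge0.
  rewrite (_ : _ - _ = t `^ w * ((t `^ d - q) * (t `^ e - c `^ e))); last by ring.
  rewrite mulr_ge0 ?powR_ge0// -cd.
  have [tc|ct] := leP t c.
    by rewrite mulr_le0// subr_le0 ge0_ler_powR ?nnegrE ?(ltW d0) ?(ltW t0) ?(ltW c0).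
  by rewrite mulr_ge0// subr_ge0 ge0_ler_powR ?nnegrE ?(ltW d0) ?(ltW t0) ?(ltW c0) ?(ltW ct).
rewrite (_ : q * c `^ e * gammaR x = c `^ e * gammaR (x + d)); last first.
  by rewrite /q; field; rewrite gt_eqF.
rewrite mul1r addrC lerD2r /q -(ler_pM2l Gx) !mulrA.
by rewrite [gammaR x * gammaR (x + d)]mulrC mulfK ?gt_eqF.
Qed.

End GammaTheory.

(** * Completely monotone sequences and Kilbas-Saigo functions *)

Section CompletelyMonotone.
Variable R : realFieldType.
Implicit Types (f g w p : nat -> R) (M x : R).

Definition mdiff M f k := M * f k - f k.+1.
Definition next f k := f k.+1.

(** The powers of [M - S] up to order [n], with [S] the shift, send [f] to nonnegative sequences.
    Required for every [n] with [M = 1], this is Hausdorff's complete monotonicity, which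
    characterizes the moment sequences on [0, 1]; a general [M > 0] corresponds to [0, M]. *)
Fixpoint cmono M n f : Prop :=
  (forall k, 0 <= f k) /\ (if n is n'.+1 then cmono M n' (mdiff M f) else True).

Definition cmonotone M f := forall n, cmono M n f.

Lemma cmono_ge0 M n f k : cmono M n f -> 0 <= f k.
Proof. by case: n => [|n] [f0 _]; exact: f0. Qed.

Lemma cmonoW M n f : cmono M n.+1 f -> cmono M n f.
Proof.
elim: n f => [|n IH] f [f0 fn]; first by [].
by split => //; apply: IH.
Qed.

Lemma cmonotone_mdiff M f : cmonotone M f -> cmonotone M (mdiff M f).
Proof. by move=> fM n; have [] := fM n.+1. Qed.

Lemma cmono_shift M n f : cmono M n f -> cmono M n (next f).
Proof.
elim: n f => [|n IH] f [f0 fn]; (split; first by move=> k; exact: f0) => //.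
exact: (IH _ fn).
Qed.

Lemma cmonoD M n f g : cmono M n f -> cmono M n g ->
  cmono M n (fun k => f k + g k).
Proof.
elim: n f g => [|n IH] f g [f0 fn] [g0 gn];
  (split; first by move=> k; rewrite addr_ge0) => //.
have -> : mdiff M (fun k => f k + g k) = (fun k => mdiff M f k + mdiff M g k).
  by apply/funext => k; rewrite /mdiff; ring.
exact: IH.
Qed.

Lemma cmonoZ M n c f : 0 <= c -> cmono M n f -> cmono M n (fun k => c * f k).
Proof.
move=> c0; elim: n f => [|n IH] f [f0 fn];
  (split; first by move=> k; rewrite mulr_ge0) => //.
have -> : mdiff M (fun k => c * f k) = (fun k => c * mdiff M f k).
  by apply/funext => k; rewrite /mdiff; ring.
exact: IH.
Qed.

(** Leibniz rule: [(M - S)(w p) = (S w) (M - S) p + M ((1 - S) w) p], and both terms are of lower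
    order. *)
Lemma cmonoM M n w p : 0 <= M -> cmono 1 n w -> cmono M n p ->
  cmono M n (fun k => w k * p k).
Proof.
move=> M0; elim: n w p => [|n IH] w p wn pn.
  by split => // k; rewrite mulr_ge0// (cmono_ge0 _ wn, cmono_ge0 _ pn).
split=> [k|]; first by rewrite mulr_ge0// (cmono_ge0 _ wn, cmono_ge0 _ pn).
have -> : mdiff M (fun k => w k * p k) =
    (fun k => next w k * mdiff M p k + M * (mdiff 1 w k * p k)).
  by apply/funext => k; rewrite /mdiff /next; ring.
apply: cmonoD.
  by apply: IH; [exact/cmono_shift/cmonoW|case: pn].
by apply: cmonoZ => //; apply: IH; [case: wn|exact: cmonoW].
Qed.

Lemma cmonotone_sum M (I : Type) (s : seq I) (F : I -> nat -> R) :
  (forall i, cmonotone M (F i)) -> cmonotone M (fun k => \sum_(i <- s) F i k).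
Proof.
move=> FM n; elim: s => [|i s IH].
  under [X in cmono _ _ X]eq_fun do rewrite big_nil.
  elim: n => [|n IH]; first by [].
  by split => //; rewrite (_ : mdiff _ _ = fun=> 0)//; apply/funext => k;
    rewrite /mdiff; ring.
under [X in cmono _ _ X]eq_fun do rewrite big_cons.
by apply: cmonoD => //; exact: FM.
Qed.

(** The difference of the sequence and its shift is [a] times the product of the two, so the
    induction closes by stability under products. *)
Lemma cmonotone_inv (a b : R) : 0 <= a -> 0 < b ->
  cmonotone 1 (fun k => (a * k%:R + b)^-1).
Proof.
move=> a0 b0; have pos k : 0 < a * k%:R + b.
  by rewrite ltr_wpDl// mulr_ge0.
elim=> [|n IH]; first by split => // k; rewrite invr_ge0 ltW.
split=> [k|]; first by rewrite invr_ge0 ltW.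
have -> : mdiff 1 (fun k => (a * k%:R + b)^-1) =
    (fun k => a * ((a * k%:R + b)^-1 * next (fun k => (a * k%:R + b)^-1) k)).
  apply/funext => k; rewrite /mdiff /next -natr1.
  have := pos k.+1; rewrite -natr1 => /lt0r_neq0 h1.
  by have /lt0r_neq0 h2 := pos k; field; apply/andP.
by apply: cmonoZ => //; apply: cmonoM => //; exact: cmono_shift.
Qed.

(** The product [p] satisfies [(M - S) p = w p], so each further power of [M - S] costs only a
    multiplication by a completely monotone sequence. *)
Lemma cmonotone_prod M w : 0 <= M -> cmonotone 1 w -> (forall k, w k <= M) ->
  cmonotone M (fun k => \prod_(j < k) (M - w j)).
Proof.
move=> M0 wM wle; have p0 k : 0 <= \prod_(j < k) (M - w j).
  by apply: prodr_ge0 => j _; rewrite subr_ge0.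
elim=> [|n IH]; first by [].
split=> //.
have -> : mdiff M (fun k => \prod_(j < k) (M - w j)) =
    (fun k => w k * \prod_(j < k) (M - w j)).
  by apply/funext => k; rewrite /mdiff big_ord_recr/=; ring.
exact: cmonoM.
Qed.

(* one step of Euler's scheme: [euler x = 1 - x S] with [S] the shift *)
Definition euler x f k := f k - x * f k.+1.

(** [1 - x S = (1 - x M) + x (M - S)] has nonnegative coefficients as long as [x M <= 1]. *)
Lemma cmonotone_euler M x f : 0 <= x -> x * M <= 1 ->
  cmonotone M f -> cmonotone M (euler x f).
Proof.
move=> x0 xM fM n.
have -> : euler x f = (fun k => (1 - x * M) * f k + x * mdiff M f k).
  by apply/funext => k; rewrite /euler /mdiff; ring.
by apply: cmonoD; apply: cmonoZ; rewrite ?subr_ge0//; exact: cmonotone_mdiff.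
Qed.

Lemma cmonotone_iter_euler M x f N : 0 <= x -> x * M <= 1 ->
  cmonotone M f -> cmonotone M (iter N (euler x) f).
Proof. by move=> x0 xM fM; elim: N => //= N; exact: cmonotone_euler. Qed.

(** The difference of the two iterates obeys the scheme with step [x] and the source
    [(x - x0) S f0]. The induction carries its complete monotonicity, since mere nonnegativity is
    not preserved by [euler]. *)
Lemma iter_euler_le M x0 x f N k : 0 <= x0 <= x -> x * M <= 1 -> 0 <= M ->
  cmonotone M f -> iter N (euler x) f k <= iter N (euler x0) f k.
Proof.
move=> /andP[x00 x0x] xM M0 fM; rewrite -subr_ge0.
have xge0 : 0 <= x := le_trans x00 x0x.
have x0M : x0 * M <= 1 by rewrite (le_trans _ xM)// ler_wpM2r.
suff h : cmonotone M (fun k => iter N (euler x0) f k - iter N (euler x) f k).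
  exact: (cmono_ge0 k (h 0%N)).
elim: N => [|N IH] n /=.
  rewrite (_ : (fun k => _) = fun k => 0 * f k); first exact: cmonoZ.
  by apply/funext => j; ring.
set f0 := iter N (euler x0) f; set f1 := iter N (euler x) f.
have -> : (fun k => euler x0 f0 k - euler x f1 k) =
    (fun k => euler x (fun k => f0 k - f1 k) k + (x - x0) * next f0 k).
  by apply/funext => j; rewrite /euler /next; ring.
apply: cmonoD; first exact: cmonotone_euler.
apply: cmonoZ; rewrite ?subr_ge0//; apply: cmono_shift.
exact: cmonotone_iter_euler.
Qed.

(** Bonferroni-type truncation of the binomial expansion: one step of the scheme applied to the
    quadratic polynomial falls short of the next one by [N (N - 1) / 2 * x^3 S^3 f], a completely
    monotone sequence. *)
Lemma iter_euler_le_quadratic M x f N k : 0 <= x -> x * M <= 1 ->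
  cmonotone M f -> iter N (euler x) f k <=
    f k - N%:R * x * f k.+1 + N%:R * (N%:R - 1) / 2 * x ^+ 2 * f k.+2.
Proof.
move=> x0 xM fM; rewrite -subr_ge0.
pose u N k := f k - N%:R * x * f k.+1 + N%:R * (N%:R - 1) / 2 * x ^+ 2 * f k.+2.
suff h : cmonotone M (fun k => u N k - iter N (euler x) f k).
  exact: (cmono_ge0 k (h 0%N)).
elim: N => [|N IH] n /=.
  rewrite (_ : (fun k => _) = fun k => 0 * f k); first exact: cmonoZ.
  by apply/funext => j; rewrite /u; ring.
set f1 := iter N (euler x) f.
have -> : (fun k => u N.+1 k - euler x f1 k) =
    (fun k => euler x (fun k => u N k - f1 k) k +
      N%:R * (N%:R - 1) / 2 * x ^+ 3 * next (next (next f)) k).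
  by apply/funext => j; rewrite /u /euler /next -natr1; field.
apply: cmonoD; first exact: cmonotone_euler.
apply: cmonoZ; last by do 3 apply: cmono_shift; exact: fM.
rewrite mulr_ge0 ?exprn_ge0// divr_ge0//.
by case: (N) => [|m]; rewrite ?mul0r// -natr1 addrK mulr_ge0.
Qed.

(** Binomial theorem for [1 - x S], by Pascal's rule. *)
Lemma iter_eulerE x f N k :
  iter N (euler x) f k = \sum_(i < N.+1) 'C(N, i)%:R * (- x) ^+ i * f (k + i)%N.
Proof.
elim: N k => [|N IH] k; first by rewrite big_ord1/= bin0 addn0; ring.
rewrite iterS /euler !IH big_ord_recl [RHS]big_ord_recl/= !bin0 !addn0.
rewrite -addrA; congr (_ + _).
rewrite [in RHS]big_ord_recr/= [in LHS]mulr_sumr -sumrN [X in _ + X = _]big_ord_recr/=.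
rewrite [RHS](_ : _ =
  \sum_(i < N) ('C(N, bump 0 i)%:R * (- x) ^+ bump 0 i * f (k + bump 0 i)%N) +
  (\sum_(i < N) - (x * ('C(N, i)%:R * (- x) ^+ i * f (k.+1 + i)%N)) +
   'C(N.+1, bump 0 N)%:R * (- x) ^+ bump 0 N * f (k + bump 0 N)%N)).
  congr (_ + (_ + _)).
  by rewrite /bump /= !add1n !binn exprS addSnnS; ring.
rewrite addrA -big_split/=; congr (_ + _); apply: eq_bigr => i _.
rewrite /bump/= add1n binS natrD exprS addSnnS; ring.
Qed.

End CompletelyMonotone.

(** * Upper bound for power series on the negative half-line *)

Section PowerSeriesBound.
Variable R : realType.
Implicit Types (r c : nat -> R) (y : R).

(** Ratio test: from [J] on, each term is at most half of the preceding one. The threshold uses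
    [y + 1] so that [y = 0] is covered. *)
Lemma is_cvg_series_prod r y : (forall j, 0 <= r j) ->
  (forall e, 0 < e -> exists J, forall j, (J <= j)%N -> r j <= e) -> 0 <= y ->
  cvgn (series (fun k => (\prod_(j < k) r j) * y ^+ k)).
Proof.
move=> r0 rlim y0; have y1 : 0 < y + 1 by rewrite ltr_wpDl.
have [J rJ] := rlim (2 * (y + 1))^-1 ltac:(by rewrite invr_gt0 mulr_gt0).
pose a k := (\prod_(j < k) r j) * y ^+ k.
have a0 k : 0 <= a k by rewrite mulr_ge0 ?exprn_ge0// prodr_ge0.
have aS k : (J <= k)%N -> a k.+1 <= a k / 2.
  move=> Jk; rewrite /a big_ord_recr/= exprS.
  rewrite (_ : _ * _ * _ = (\prod_(j < k) r j) * y ^+ k * (r k * y)); last by ring.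
  rewrite ler_wpM2l// ?a0// (@le_trans _ _ ((2 * (y + 1))^-1 * y))//.
    by rewrite ler_wpM2r// rJ.
  rewrite invfM -mulrA ler_piMr ?invr_ge0//.
  by rewrite mulrC ler_pdivrMr// mul1r lerDl.
(* A sum of nonnegative terms stands in for the maximum of [a i * 2 ^+ i] over [i <= J]. *)
pose A := \sum_(i < J.+1) a i * 2 ^+ i.
have aA k : a k <= geometric A 2^-1 k.
  rewrite /geometric/= exprVn ler_pdivlMr ?exprn_gt0//.
  have small i : (i <= J)%N -> a i * 2 ^+ i <= A.
    move=> iJ; rewrite /A (bigD1 (Ordinal (iJ : (i < J.+1)%N)))//= lerDl.
    by apply: sumr_ge0 => *; rewrite mulr_ge0 ?exprn_ge0.
  elim: k => [|k IH]; first exact: small.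
  have [kJ|Jk] := leqP k.+1 J; first exact: small.
  apply: le_trans IH; rewrite exprS mulrA ler_wpM2r ?exprn_ge0//.
  by rewrite -ler_pdivlMr// aS.
apply: (series_le_cvg a0 _ aA).
- by move=> k; rewrite (le_trans (a0 k)).
- by apply: is_cvg_geometric_series; rewrite ger0_norm ?invf_lt1 ?ltr1n.
Qed.

(** Falling factorial of [N] of length [k] over [N^k]: the factor by which the coefficient of [S^k]
    in [(1 - (y / N) S)^N] differs from [(- y)^k / k!]. *)
Let q (N k : nat) : R := 'C(N, k)%:R * k`!%:R / N%:R ^+ k.

Let qS N k : q N.+1 k.+1 = q N.+1 k * ((N.+1 - k)%:R / N.+1%:R).
Proof.
rewrite /q factS natrM exprS invfM; have := mul_bin_left N.+1 k.
move=> /(congr1 (fun n => n%:R : R)); rewrite !natrM => h.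
rewrite !mulrA [_ * k.+1%:R]mulrC h; ring.
Qed.

Let q_ge0 N k : 0 <= q N k.
Proof. by rewrite /q !mulr_ge0// invr_ge0 exprn_ge0. Qed.

Let q_le1 N k : q N.+1 k <= 1.
Proof.
elim: k => [|k IH]; first by rewrite /q bin0 fact0 expr0 !mul1r invr1.
rewrite qS mulr_ile1// ?q_ge0//.
by rewrite ler_pdivrMr// mul1r ler_nat leq_subr.
Qed.

Let q_cvg (N : nat -> nat) k : (forall n, n <= N n)%N ->
  (fun n => q (N n).+1 k) @ \oo --> (1 : R).
Proof.
move=> nN; elim: k => [|k IH].
  rewrite [X in X @ _](_ : _ = fun=> 1); first exact: cvg_cst.
  by apply/funext => n; rewrite /q bin0 fact0 expr0 !mul1r invr1.
rewrite [X in X @ _](_ : _ = fun n => q (N n).+1 k * (((N n).+1 - k)%:R / (N n).+1%:R));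
  last by apply/funext => n; rewrite qS.
rewrite -[X in _ --> X](mulr1 1); apply: cvgM; first exact: IH.
apply: (@squeeze_cvgr _ _ _ _ (fun n => 1 - k%:R * harmonic n) (fun=> 1)).
- near=> n; apply/andP; split; last by rewrite ler_pdivrMr// mul1r ler_nat leq_subr.
  have kn : (k <= n)%N by near: n; exact: nbhs_infty_ge.
  rewrite natrB; last by rewrite (leq_trans kn)// (leq_trans (nN n)).
  rewrite mulrBl divff// lerD2l lerN2 ler_wpM2l// lef_pV2 ?posrE// ler_nat ltnS.
  exact: nN.
- rewrite -[X in _ --> X](subr0 1) -[X in _ - X](mulr0 k%:R).
  by apply: cvgB; [exact: cvg_cst|apply: cvgM; [exact: cvg_cst|exact: cvg_harmonic]].
- exact: cvg_cst.
Unshelve. all: by end_near. Qed.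

(* With [p] the product of the approximations [M n - v n], Euler's scheme
   [(1 - (y / N) S)^N p] is a polynomial that tends to the power series; its
   complete monotonicity gives the bound. *)
Lemma lim_series_prod_le r (M : nat -> R) (v : nat -> nat -> R) y0 y :
  (forall n, 0 <= M n) -> (forall n, cmonotone 1 (v n)) ->
  (forall n k, v n k <= M n) -> (forall n k, M n - v n k <= k.+1%:R * r k) ->
  (forall k, (fun n => M n - v n k) @ \oo --> k.+1%:R * r k) ->
  0 <= y0 <= y ->
  cvgn (series (fun k => (\prod_(j < k) r j) * y ^+ k)) ->
  limn (series (fun k => (\prod_(j < k) r j) * (- y) ^+ k)) <=
    1 - y0 * r 0%N + y0 ^+ 2 * (r 0%N * r 1%N).
Proof.
move=> M0 vcm vM vr vlim /andP[y00 y0y] cvgb.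
have y_ge0 : 0 <= y := le_trans y00 y0y.
have Mv0 n k : 0 <= M n - v n k by rewrite subr_ge0.
have r0 k : 0 <= r k.
  by have := le_trans (Mv0 0%N k) (vr 0%N k); rewrite pmulr_rge0.
pose p n k := \prod_(j < k) (M n - v n j).
pose c k := \prod_(j < k) r j.
have c0 k : 0 <= c k by apply: prodr_ge0.
pose b k := c k * y ^+ k.
have b0 k : 0 <= b k by rewrite mulr_ge0 ?exprn_ge0.
(* The summand [n] makes the number of steps tend to infinity; the other one makes the step small
   enough for [y / (N n).+1 * M n <= 1]. *)
pose N n := (n + Num.bound (y * M n))%N.
have yMN n : y / (N n).+1%:R * M n <= 1.
  rewrite mulrAC ler_pdivrMr// mul1r.
  have /ltW h : y * M n < (Num.bound (y * M n))%:R by rewrite archi_boundP// mulr_ge0.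
  by rewrite (le_trans h)// ler_nat -addnS (leq_trans _ (leq_addl _ _))// leqnSn.
pose a n k := 'C((N n).+1, k)%:R * (- (y / (N n).+1%:R)) ^+ k * p n k.
have facc k : k`!%:R * c k = \prod_(j < k) (j.+1%:R * r j).
  rewrite big_split/=; congr (_ * _).
  by rewrite fact_prod natr_prod big_add1 big_mkord.
have aE n k : a n k = q (N n).+1 k * (- y) ^+ k * (k`!%:R^-1 * p n k).
  rewrite /a /q -mulNr exprMn exprVn; field.
  by rewrite pnatr_eq0 -lt0n fact_gt0/= expf_neq0.
have p0 n k : 0 <= p n k by apply: prodr_ge0.
have pc n k : k`!%:R^-1 * p n k <= c k.
  rewrite mulrC ler_pdivrMr ?ltr0n ?fact_gt0// mulrC facc.
  by apply: ler_prod => j _; rewrite Mv0 vr.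
have ab n k : `|a n k| <= b k.
  rewrite aE normrM (normrM (q _ _)) normrX normrN [`|y|]ger0_norm//.
  rewrite (ger0_norm (q_ge0 _ _)) (@ger0_norm _ (_^-1 * _)) ?mulr_ge0 ?invr_ge0//.
  rewrite /b mulrC ler_pM ?mulr_ge0 ?invr_ge0 ?exprn_ge0 ?q_ge0//.
  by rewrite ler_piMl ?exprn_ge0.
have acvg k : a^~ k @ \oo --> c k * (- y) ^+ k.
  rewrite [X in X @ _](_ : _ = fun n => q (N n).+1 k * (- y) ^+ k * (k`!%:R^-1 * p n k));
    last by apply/funext => n; rewrite aE.
  rewrite (_ : c k * _ = 1 * (- y) ^+ k * (k`!%:R^-1 * (k`!%:R * c k))); last first.
    by rewrite mulKf ?pnatr_eq0 -?lt0n ?fact_gt0// mul1r mulrC.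
  apply: cvgM; apply: cvgM; try exact: cvg_cst.
    by apply: q_cvg => n; exact: leq_addr.
  rewrite facc; elim: k => [|k IH].
    rewrite big_ord0 [X in X @ _](_ : _ = fun=> 1); first exact: cvg_cst.
    by apply/funext => n; rewrite /p big_ord0.
  rewrite big_ord_recr/= [X in X @ _](_ : _ = fun n => p n k * (M n - v n k)).
    by apply: cvgM; [exact: IH|exact: vlim].
  by apply/funext => n; rewrite /p big_ord_recr.
pose U n := 1 - y0 * p n 1%N + 2^-1 * y0 ^+ 2 * p n 2.
(* The sum is the value at index 0 of the iterated scheme. Decreasing [y] to [y0] increases it, and
   only then is it truncated at order two. *)
have aU n : \sum_(k < (N n).+2) a n k <= U n.
  have pM : cmonotone (M n) (p n) by apply: cmonotone_prod.
  have x0 : 0 <= y / (N n).+1%:R by rewrite divr_ge0.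
  have := @iter_eulerE R (y / (N n).+1%:R) (p n) (N n).+1 0.
  rewrite (_ : \sum_(_ < _) _ = \sum_(k < (N n).+2) a n k); last first.
    by apply: eq_bigr => k _; rewrite add0n.
  move=> <-.
  have x1 : 0 <= y0 / (N n).+1%:R <= y / (N n).+1%:R.
    by rewrite divr_ge0//= ler_wpM2r// invr_ge0.
  apply: le_trans (iter_euler_le _ _ x1 (yMN n) (M0 n) pM) _.
  have [x1a x1b] := andP x1.
  have x1M : y0 / (N n).+1%:R * M n <= 1.
    by rewrite (le_trans _ (yMN n))// ler_wpM2r.
  apply: le_trans (iter_euler_le_quadratic _ _ x1a x1M pM) _.
  rewrite {1}/p big_ord0 /U; apply: lerD.
    rewrite (_ : _ * _ * _ = y0 * p n 1%N)//.
    by rewrite [_.+1%:R * _]mulrC divfK.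
  rewrite ler_wpM2r// (_ : _ * _ ^+ 2 = 2^-1 * y0 ^+ 2 * (((N n).+1%:R - 1) / (N n).+1%:R)).
    rewrite ler_piMr ?mulr_ge0 ?invr_ge0 ?exprn_ge0//.
    by rewrite ler_pdivrMr// mul1r gerBl.
  by field.
have Ucvg : U @ \oo --> 1 - y0 * r 0%N + y0 ^+ 2 * (r 0%N * r 1%N).
  have p1 : p^~ 1%N @ \oo --> r 0%N.
    rewrite [X in X @ _](_ : _ = fun n => M n - v n 0%N).
      by rewrite -[X in _ --> X]mul1r; exact: vlim.
    by apply/funext => n; rewrite /p big_ord1.
  (* The limit of [M n - v n 1] is [2 * r 1]; this 2 cancels the [2^-1] in [U]. *)
  have p2 : p^~ 2 @ \oo --> r 0%N * (2 * r 1%N).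
    rewrite [X in X @ _](_ : _ = fun n => p n 1%N * (M n - v n 1%N)).
      by apply: cvgM; [exact: p1|exact: vlim].
    by apply/funext => n; rewrite /p big_ord_recr.
  rewrite (_ : y0 ^+ 2 * _ = 2^-1 * y0 ^+ 2 * (r 0%N * (2 * r 1%N))); last by field.
  apply: cvgD; last by apply: cvgM; [exact: cvg_cst|exact: p2].
  by apply: cvgB; [exact: cvg_cst|apply: cvgM; [exact: cvg_cst|exact: p1]].
have sumb K L : (K <= L)%N -> \sum_(k < L) b k - \sum_(k < K) b k <=
    limn (series b) - \sum_(k < K) b k.
  move=> KL; rewrite lerD2r.
  have ndb : nondecreasing_seq (series b).
    by apply: nondecreasing_series => k _ _; exact: b0.
  rewrite -(big_mkord xpredT); exact: nondecreasing_cvgn_le ndb cvgb L.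
(* Tannery's argument: the terms of index at least [K] of the [n]-th polynomial are dominated,
   uniformly in [n], by the tail of the convergent series of [b]. *)
have partial K : \sum_(k < K) c k * (- y) ^+ k <=
    1 - y0 * r 0%N + y0 ^+ 2 * (r 0%N * r 1%N) + (limn (series b) - \sum_(k < K) b k).
  apply: (@ler_cvg_to _ \oo _ _ (fun n => \sum_(k < K) a n k)
     (fun n => U n + (limn (series b) - \sum_(k < K) b k)) ).
  - by apply: cvg_big => [|k _]; [exact: add_continuous|exact: acvg].
  - by apply: cvgD => //; exact: cvg_cst.
  near=> n; have KN : (K <= (N n).+2)%N.
    have : (K <= n)%N by near: n; exact: nbhs_infty_ge.
    by move=> Kn; rewrite (leq_trans Kn)// /N -!addnS leq_addr.
  rewrite (le_trans _ (lerD (aU n) (sumb _ _ KN)))//.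
  rewrite -!(big_mkord xpredT) (@big_cat_nat _ _ _ K 0 (N n).+2)//=
    (@big_cat_nat _ _ _ K 0 (N n).+2 _ b)//=.
  rewrite [X in _ + (X - _)]addrC addrK -addrA lerDl -big_split/= sumr_ge0// => k _.
  by rewrite addrC -lerBlDr sub0r (le_trans _ (ab n k))// ler_normr lexx orbT.
have sE (u : nat -> R) K : series u K = \sum_(k < K) u k.
  by rewrite /series/= big_mkord.
have cvga : cvgn (series (fun k => c k * (- y) ^+ k)).
  apply: normed_cvg; rewrite (_ : [normed series _]%R = series b)//.
  by congr series; apply/funext => k /=; rewrite normrM normrX normrN
    [`|y|]ger0_norm// (ger0_norm (c0 k)).
apply: (@ler_cvg_to _ \oo _ _ _ (fun K => 1 - y0 * r 0%N + y0 ^+ 2 * (r 0%N * r 1%N) +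
    (limn (series b) - series b K)) _ _ cvga); last first.
  by apply: nearW => K; rewrite !sE; exact: partial.
rewrite -[X in _ --> X]addr0 -[X in _ --> _ + X](subrr (limn (series b))).
by apply: cvgD; [exact: cvg_cst|apply: cvgB; [exact: cvg_cst|exact: cvgb]].
Unshelve. all: by end_near. Qed.

End PowerSeriesBound.

(** * The quotient Gamma (z + 1) / Gamma (z + alpha) and its rational approximations *)

Section GammaQuotient.
Variables (R : realType) (alpha : R).
Hypothesis alpha01 : 0 < alpha <= 1.
Let alpha0 : 0 < alpha. Proof. by case/andP: alpha01. Qed.
Let alpha1 : alpha <= 1. Proof. by case/andP: alpha01. Qed.

(** Multiplied by [n^(1 - alpha)], this is Euler's product for Gamma (z + 1) / Gamma (z + alpha). *)
Definition euler_prod n z : R := \prod_(i < n) ((z + alpha + i%:R) / (z + 1 + i%:R)).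

Lemma euler_prod_ge0 n z : 0 <= z -> 0 <= euler_prod n z.
Proof.
move=> z0; apply: prodr_ge0 => i _.
by rewrite divr_ge0 ?addr_ge0// ltW.
Qed.

(* Partial fractions; the residues are nonnegative because poles and zeros
   interlace. *)
Lemma euler_prod_partial_fractions n : exists2 A : nat -> R, (forall j, 0 <= A j) &
  forall z, 0 <= z -> euler_prod n z = 1 - \sum_(j < n) A j / (z + 1 + j%:R).
Proof.
elim: n => [|n [A A0 AE]].
  by exists (fun=> 0) => // z z0; rewrite /euler_prod !big_ord0 subr0.
(* The new factor is [1 - (1 - alpha) / (z + 1 + n)]. An old residue is multiplied by its value at
   the pole [z = - 1 - j]; the new one is [1 - alpha] times the value of the old product at
   [z = - 1 - n]. *)
pose B j := if j == n then (1 - alpha) * (1 + \sum_(i < n) A i / (n - i)%:R)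
  else A j * (1 - (1 - alpha) / (n - j)%:R).
have a10 : 0 <= 1 - alpha by rewrite subr_ge0.
have B0 j : (j <= n)%N -> 0 <= B j.
  rewrite leq_eqVlt /B => /predU1P[->|jn].
    rewrite eqxx mulr_ge0// addr_ge0// sumr_ge0// => i _.
    by rewrite divr_ge0.
  rewrite ltn_eqF// mulr_ge0// subr_ge0 ler_pdivrMr ?ltr0n ?subn_gt0// mul1r.
  by rewrite (@le_trans _ _ 1) ?gerBl ?(ltW alpha0)// ler1n subn_gt0.
exists (fun j => if (j <= n)%N then B j else 0) => [j|z z0].
  by case: ifP => // /B0.
rewrite /euler_prod big_ord_recr/= -/(euler_prod n z) AE// [in RHS]big_ord_recr/= leqnn.
under [in RHS]eq_bigr => j _ do rewrite (ltnW (ltn_ord j)).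
rewrite {2}/B eqxx.
have zn k : z + 1 + k%:R != 0.
  by rewrite gt_eqF// ltr_wpDr// ltr_wpDl.
have -> : \sum_(j < n) B j / (z + 1 + j%:R) =
    \sum_(j < n) A j / (z + 1 + j%:R) - (1 - alpha) *
     (\sum_(j < n) A j / (n - j)%:R / (z + 1 + j%:R)).
  rewrite mulr_sumr -sumrB; apply: eq_bigr => j _.
  by rewrite /B ltn_eqF//; ring.
have key : (\sum_(j < n) A j / (n - j)%:R / (z + 1 + j%:R)) =
    (\sum_(j < n) A j / (z + 1 + j%:R) + \sum_(j < n) A j / (n - j)%:R) /
      (z + 1 + n%:R).
  rewrite -big_split/= mulr_suml; apply: eq_bigr => j _.
  have nj : (n%:R - j%:R : R) != 0.
    by rewrite subr_eq0 eqr_nat gtn_eqF.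
  rewrite natrB; last exact: ltnW.
  by field; rewrite nj !zn.
rewrite key; set S := \sum_(j < n) _; set S' := \sum_(j < n) _.
by have := zn n; move=> h; field.
Qed.

(** This is Gamma (z + 1) / Gamma (z + alpha), with the denominator shifted by the functional
    equation so that every argument is at least 1 when [z >= 0]. *)
Definition gamma_quot z : R := (z + alpha) * gammaR (z + 1) / gammaR (z + 1 + alpha).

Lemma gamma_quotS z : 0 <= z ->
  gamma_quot z = (z + alpha) / (z + 1) * gamma_quot (z + 1).
Proof.
move=> z0; rewrite /gamma_quot.
have z11 : 1 <= z + 1 by rewrite lerDr.
have z1a : 1 <= z + 1 + alpha by rewrite ler_wpDr// ltW.
have -> : z + 1 + 1 + alpha = (z + 1 + alpha) + 1 by ring.
rewrite (gammaRS z11) (gammaRS z1a); field.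
have G := gammaR_gt0 z1a.
by rewrite !gt_eqF// (lt_le_trans _ z1a, lt_le_trans _ z11).
Qed.

Lemma gamma_quot_prod n z : 0 <= z ->
  gamma_quot z = euler_prod n z * gamma_quot (z + n%:R).
Proof.
move=> z0; elim: n => [|n IH]; first by rewrite /euler_prod big_ord0 addr0 mul1r.
rewrite IH gamma_quotS ?addr_ge0// /euler_prod big_ord_recr/=.
have -> : z + n%:R + 1 = z + n.+1%:R by rewrite -natr1 addrA.
by rewrite !mulrA (addrAC z n%:R) -natr1 (addrAC z 1) addrA.
Qed.

Lemma gamma_quot_gt0 z : 0 <= z -> 0 < gamma_quot z.
Proof.
move=> z0; rewrite /gamma_quot divr_gt0 ?mulr_gt0//.
- by rewrite ltr_wpDl.
- by rewrite gammaR_gt0// lerDr.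
- by rewrite gammaR_gt0// ler_wpDr ?lerDr// ltW.
Qed.

(** For arguments at least 1 the denominator can be shifted back; [gammaR_ratio_le] with increment
    [1 - alpha] then takes [z + alpha] to [z + 1]. *)
Lemma gamma_quot_le z z' : 1 <= z <= z' -> gamma_quot z <= gamma_quot z'.
Proof.
move=> /andP[z1 zz']; have z'1 : 1 <= z' := le_trans z1 zz'.
have za w : 1 <= w -> 1 <= w + alpha by move=> ?; rewrite ler_wpDr// ltW.
have E w : 1 <= w -> gamma_quot w = gammaR (w + 1) / gammaR (w + alpha).
  move=> w1; rewrite /gamma_quot (addrAC w 1) (gammaRS (za _ w1)); field.
  by rewrite !gt_eqF ?gammaR_gt0 ?za// (lt_le_trans _ (za _ w1)).
rewrite !E// ler_pdivrMr ?gammaR_gt0 ?za// mulrAC ler_pdivlMr ?gammaR_gt0 ?za//.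
have := @gammaR_ratio_le R (z + alpha) (z' + alpha) (1 - alpha).
by rewrite za// lerD2r zz' subr_ge0 alpha1 -!addrA subrKC mulrC [X in _ -> _ <= X]mulrC; exact.
Qed.

Lemma euler_prod_cvg1 z k : 0 <= z ->
  (fun n => euler_prod k (z + n%:R)) @ \oo --> (1 : R).
Proof.
move=> z0; rewrite /euler_prod; elim: k => [|k IH].
  by rewrite [X in X @ _](_ : _ = fun=> 1); [exact: cvg_cst|apply/funext => n; rewrite big_ord0].
rewrite [X in X @ _](_ : _ = fun n => euler_prod k (z + n%:R) *
    ((z + n%:R + alpha + k%:R) / (z + n%:R + 1 + k%:R))); last first.
  by apply/funext => n; rewrite big_ord_recr.
rewrite -[X in _ --> X](mulr1 1); apply: cvgM; first exact: IH.
apply: (@squeeze_cvgr _ _ _ _ (fun n => 1 - harmonic n) (fun=> 1)).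
- apply: nearW => n; have pos : 0 < z + n%:R + 1 + k%:R.
    by rewrite ltr_wpDr// ltr_wpDl ?addr_ge0.
  apply/andP; split; last by rewrite ler_pdivrMr// mul1r lerD2r lerD2l.
  rewrite (_ : _ / _ = 1 - (1 - alpha) / (z + n%:R + 1 + k%:R)); last first.
    by field; rewrite gt_eqF.
  rewrite lerD2l lerN2 -[leRHS]mul1r ler_pM ?invr_ge0 ?subr_ge0 ?(ltW pos)//.
    by rewrite gerBl ltW.
  by rewrite lef_pV2 ?posrE// -natr1 ler_wpDr// lerD2r lerDr.
- rewrite -[X in _ --> X](subr0 1); apply: cvgB; first exact: cvg_cst.
  exact: cvg_harmonic.
- exact: cvg_cst.
Qed.

Variables beta : R.
Hypothesis beta0 : 0 <= beta.
Let gam := alpha + beta.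
Let gam0 : 0 < gam. Proof. by rewrite ltr_wpDr. Qed.

(* [gamma_step j] is the quotient of two consecutive coefficients of the
   Kilbas-Saigo function E_{alpha, 1 + beta/alpha, beta/alpha} *)
Definition gamma_step (j : nat) : R :=
  gammaR (gam * j%:R + beta + 1) / gammaR (gam * j%:R + beta + 1 + alpha).

Let zj j := gam * j%:R + beta.
Let zj0 j : 0 <= zj j. Proof. by rewrite addr_ge0// mulr_ge0// ltW. Qed.

Lemma gamma_step_gt0 j : 0 < gamma_step j.
Proof.
have z1 : 1 <= gam * j%:R + beta + 1 by rewrite lerDr zj0.
by rewrite /gamma_step divr_gt0// gammaR_gt0// ler_wpDr// ltW.
Qed.

(** The numerator factor [zj j + alpha] of [gamma_quot] equals [gam * j.+1]. This is what makes
    [j.+1 * gamma_step j], rather than [gamma_step j] itself, a value of the Bernstein function. *)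
Let stepE j : j.+1%:R * gamma_step j = gam^-1 * gamma_quot (zj j).
Proof.
rewrite /gamma_step /gamma_quot -/(zj j).
have -> : zj j + alpha = gam * j.+1%:R by rewrite /zj -natr1 /gam; ring.
by rewrite !mulrA mulVf ?mul1r// gt_eqF.
Qed.

Lemma gamma_step_small e : 0 < e -> exists J, forall j, (J <= j)%N -> gamma_step j <= e.
Proof.
move=> e0; pose B := (2 / e) `^ alpha^-1.
have B0 : 0 < B by rewrite powR_gt0// divr_gt0.
pose J := Num.bound ((2 * B + 1) / gam).
exists J => j Jj; rewrite /gamma_step; set x := _ + 1.
have xB : 2 * B + 2 <= x.
  rewrite /x -/(zj j) (_ : 2 * B + 2 = (2 * B + 1) + 1); last by ring.
  rewrite lerD2r /zj ler_wpDr// [gam * _]mulrC -ler_pdivrMr//.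
  have h : 0 <= (2 * B + 1) / gam by rewrite divr_ge0 ?(ltW gam0)// addr_ge0// mulr_ge0// ltW.
  by rewrite (le_trans (ltW (archi_boundP h)))// ler_nat.
have x2 : 2 <= x by rewrite (le_trans _ xB)// lerDr mulr_ge0// ltW.
(* With this [M] one has [gammaR x = 2 * M * gammaR (x - 1)], so the subtracted term in
   [gammaR_add_ge] is half of the first one. The bound [B] solves [B^alpha = 2 / e]. *)
pose M := (x - 1) / 2.
have MB : B <= M by rewrite /M ler_pdivlMr// mulrC lerBrDr (le_trans _ xB)// lerD2l ler1n.
have M0 : 0 < M := lt_le_trans B0 MB.
have x1 : 1 <= x by rewrite (le_trans _ x2)// ler1n.
have x11 : 1 <= x - 1 by rewrite lerBrDr.
have Gx := gammaR_gt0 x1; have Gx1 := gammaR_gt0 x11.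
have Gxa : 0 < gammaR (x + alpha) by rewrite gammaR_gt0// ler_wpDr// ltW.
have := gammaR_add_ge x2 (ltW alpha0) M0.
have GE : gammaR x = 2 * M * gammaR (x - 1).
  by rewrite -[in LHS](subrK 1 x) gammaRS// /M; field.
rewrite (@powRD _ M alpha 1) ?(gt_eqF M0) ?implybT// (powRr1 (ltW M0)).
rewrite (_ : _ - _ = M `^ alpha / 2 * gammaR x); last by rewrite GE; field.
move=> h; rewrite ler_pdivrMr// mulrC -ler_pdivrMr// (le_trans _ h)//.
rewrite mulrC ler_wpM2r ?(ltW Gx)//.
rewrite ler_pdivlMr// mulrC; apply: (@le_trans _ _ (B `^ alpha)); last first.
  by rewrite ge0_ler_powR ?nnegrE ?(ltW alpha0) ?(ltW B0) ?(ltW M0).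
by rewrite /B -powRrM mulVf ?gt_eqF// powRr1// divr_ge0// ltW.
Qed.

Lemma is_cvg_gamma_step_series y : 0 <= y ->
  cvgn (series (fun k => (\prod_(j < k) gamma_step j) * y ^+ k)).
Proof.
apply: is_cvg_series_prod; last exact: gamma_step_small.
by move=> j; rewrite ltW// gamma_step_gt0.
Qed.

Lemma lim_gamma_step_series_le y0 y : 0 <= y0 <= y ->
  limn (series (fun k => (\prod_(j < k) gamma_step j) * (- y) ^+ k)) <=
    1 - y0 * gamma_step 0 + y0 ^+ 2 * (gamma_step 0 * gamma_step 1).
Proof.
move=> y0y; have y_ge0 : 0 <= y by case/andP: y0y; exact: le_trans.
(* After [n.+1] factors of Euler's product, the remaining quotient is frozen at its value for
   [k = 0]. As [gamma_quot] increases on arguments at least 1, the approximation is from below. *)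
pose c n := gam^-1 * gamma_quot (beta + n.+1%:R).
have bn n : 0 <= beta + n%:R by rewrite addr_ge0.
have c0 n : 0 <= c n by rewrite mulr_ge0 ?invr_ge0 ?(ltW gam0)// ltW// gamma_quot_gt0.
have [A A0 AE] : exists2 A : nat -> nat -> R, (forall n j, 0 <= A n j) &
    forall n z, 0 <= z -> euler_prod n z = 1 - \sum_(j < n) A n j / (z + 1 + j%:R).
  pose P n := cid2 (euler_prod_partial_fractions n).
  by exists (fun n => sval (P n)) => n; rewrite /P; case: cid2.
pose v n k := c n * \sum_(j < n.+1) A n.+1 j / (zj k + 1 + j%:R).
have cvE n k : c n - v n k = c n * euler_prod n.+1 (zj k) by rewrite AE// /v; ring.
have cr n k : c n - v n k <= k.+1%:R * gamma_step k.
  rewrite cvE stepE (gamma_quot_prod n.+1 (zj0 k)) /c -mulrA ler_wpM2l ?invr_ge0 ?(ltW gam0)//.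
  rewrite mulrC ler_wpM2l ?euler_prod_ge0// gamma_quot_le//.
  rewrite ler_wpDl ?ler1n//= lerD2r /zj lerDr mulr_ge0// ltW//.
apply: (@lim_series_prod_le R gamma_step c v y0 y c0 _ _ cr _ y0y).
- move=> n m; rewrite /v; apply: cmonoZ => //; apply: cmonotone_sum => j m'.
  apply: cmonoZ => //.
  rewrite (_ : (fun k => _) = fun k => (gam * k%:R + (beta + 1 + j%:R))^-1).
    by apply: cmonotone_inv; [exact: ltW|rewrite ltr_wpDr// ltr_wpDl].
  by apply/funext => k; rewrite /zj !addrA.
- by move=> n k; rewrite -subr_ge0 cvE mulr_ge0// euler_prod_ge0.
(* Replacing the shift [gam * k] by the larger integer [m] bounds the relative error of the freezing
   by a product of [m] factors, each tending to 1. *)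
- move=> k; pose m := Num.bound (gam * k%:R).
  have gkm : gam * k%:R <= m%:R.
    by rewrite ltW// archi_boundP// mulr_ge0// ltW.
  pose w n := euler_prod m (beta + n.+1%:R).
  apply: (@squeeze_cvgr _ _ _ _ (fun n => w n * (k.+1%:R * gamma_step k))
      (fun=> k.+1%:R * gamma_step k)).
  + apply: nearW => n; rewrite cr andbT cvE stepE (gamma_quot_prod n.+1 (zj0 k)).
    rewrite (_ : _ * (_ * (_ * _)) = gam^-1 * euler_prod n.+1 (zj k) *
      (w n * gamma_quot (zj k + n.+1%:R))); last by ring.
    rewrite (_ : c n * _ = gam^-1 * euler_prod n.+1 (zj k) *
      gamma_quot (beta + n.+1%:R)); last by rewrite /c; ring.
    rewrite ler_wpM2l ?mulr_ge0 ?invr_ge0 ?(ltW gam0) ?euler_prod_ge0//.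
    rewrite (gamma_quot_prod m (bn n.+1)) ler_wpM2l ?euler_prod_ge0//.
    rewrite gamma_quot_le// ler_wpDl ?ler1n//=.
    by rewrite /zj -!addrA addrC -!addrA lerD2l lerD2l.
  + rewrite -[X in _ --> X]mul1r; apply: cvgM; last exact: cvg_cst.
    have := @euler_prod_cvg1 beta m beta0.
    by rewrite -(cvg_shiftS (fun n => euler_prod m (beta + n%:R))).
  + exact: cvg_cst.
- exact: is_cvg_gamma_step_series.
Qed.

End GammaQuotient.

(** * Lower bound for sigma_k *)

Section SigmaLowerBound.
Variables (R : realType) (alpha beta : R).
Hypotheses (alpha01 : 0 < alpha <= 1) (beta0 : 0 <= beta).
Let alpha0 : 0 < alpha. Proof. by case/andP: alpha01. Qed.
Local Notation step := (gamma_step alpha beta).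

Let GammaE (x : R) : Gamma x = gammaR x. Proof. by rewrite gammaR.unlock. Qed.

Lemma eta2E : eta2 alpha beta = step 0.
Proof. by rewrite /eta2 !GammaE /gamma_step mulr0 add0r; congr (gammaR _ / gammaR _); ring. Qed.

Lemma kilbas_saigo_coefE k :
  kilbas_saigo_coef alpha (1 + beta / alpha) (1 + 2 * beta / alpha) k =
  \prod_(j < k) step j.+1.
Proof.
apply: eq_bigr => j _; rewrite !GammaE /gamma_step -natr1.
by congr (gammaR _ / gammaR _); field; rewrite gt_eqF.
Qed.

(** Moving the third parameter from [beta / alpha] to [1 + 2 * beta / alpha] shifts the index of the
    coefficients by one. Hence the left side is the series with parameter [beta / alpha] without its
    constant term, up to sign. *)
Lemma kilbas_saigoE y : 0 < y ->
  eta2 alpha beta * y * kilbas_saigo alpha (1 + beta / alpha) (1 + 2 * beta / alpha) (- y)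
  = 1 - limn (series (fun k => (\prod_(j < k) step j) * (- y) ^+ k)).
Proof.
move=> y0; have s0 := gamma_step_gt0 alpha01 beta0 0.
have sy : step 0 * y != 0 by rewrite gt_eqF// mulr_gt0.
set a := fun k => _; set L := limn _.
have cvga : series a @ \oo --> L.
  apply: normed_cvg; have := is_cvg_gamma_step_series alpha01 beta0 (ltW y0).
  rewrite (_ : [normed series _]%R = series (fun k => (\prod_(j < k) step j) * y ^+ k))//.
  congr series; apply/funext => k /=; rewrite normrM normrX normrN (gtr0_norm y0).
  rewrite ger0_norm// prodr_ge0// => j _.
  by rewrite ltW// gamma_step_gt0.
set e := fun k => kilbas_saigo_coef alpha (1 + beta / alpha) (1 + 2 * beta / alpha) k.+1 *
  (- y) ^+ k.+1.
(* [e] starts at the first power of its own series, which is the second power of [a]: its [n] terms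
   match the first [n.+2] terms of [a]. *)
have eE n : series e n = (1 - series a n.+2) / (step 0 * y) - 1.
  have -> : series a n.+2 = 1 - step 0 * y * (1 + series e n).
    rewrite /series/= big_nat_recl// big_nat_recl//= /a big_ord0 big_ord1 expr0.
    rewrite mul1r expr1 mulrDr mulr1 opprD addrA mulrN mulr_sumr -sumrN -addrA; congr (_ + (_ + _)).
    apply: eq_bigr => k _; rewrite /e kilbas_saigo_coefE big_ord_recl/= exprS.
    by ring.
  by field; rewrite !gt_eqF.
have -> : kilbas_saigo alpha (1 + beta / alpha) (1 + 2 * beta / alpha) (- y) =
    (1 - L) / (step 0 * y).
  rewrite /kilbas_saigo -/e.
  suff -> : limn (series e) = (1 - L) / (step 0 * y) - 1 by ring.
  apply/cvg_lim => //.
  rewrite [X in X @ _](_ : _ = fun n => (1 - series a n.+2) / (step 0 * y) - 1); last first.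
    by apply/funext => n; rewrite eE.
  apply: cvgB; last exact: cvg_cst.
  apply: cvgM; last exact: cvg_cst.
  apply: cvgB; first exact: cvg_cst.
  rewrite (cvg_shiftS (fun n => series a n.+1)).
  by rewrite (cvg_shiftS (series a)).
by rewrite eta2E mulrC divfK.
Qed.

Lemma sigmaK_ge (l lam1 : R) : 0 < l -> 0 < lam1 ->
  exists2 c : R, 0 < c & forall (lam : nat -> R) k, lam1 <= lam k ->
    c / lam k <= sigmaK alpha beta l lam k.
Proof.
move=> l0 lam10; set lg := l `^ (alpha + beta).
have lg0 : 0 < lg by rewrite powR_gt0.
have s0 := gamma_step_gt0 alpha01 beta0 0; have s1 := gamma_step_gt0 alpha01 beta0 1.
pose y1 := Num.sqrt lam1 * lg.
have y10 : 0 < y1 by rewrite mulr_gt0// sqrtr_gt0.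
(* The bound [(2 * step 1)^-1] makes the quadratic term at most half of the linear one; the bound
   [y1] keeps [y0] below every [y] that occurs. *)
pose y0 := Num.min y1 (2 * step 1)^-1.
have y00 : 0 < y0 by rewrite lt_min y10 invr_gt0 mulr_gt0.
exists (y0 * step 0 / 2); first by rewrite divr_gt0// mulr_gt0.
move=> lam k lamk; have lamk0 : 0 < lam k := lt_le_trans lam10 lamk.
have sl0 : 0 < Num.sqrt (lam k) by rewrite sqrtr_gt0.
pose y := Num.sqrt (lam k) * lg.
have ypos : 0 < y by rewrite mulr_gt0.
have y0y : 0 <= y0 <= y.
  by rewrite (ltW y00)/= ge_min ler_wpM2r ?(ltW lg0)// ler_wsqrtr.
have -> : sigmaK alpha beta l lam k = (eta2 alpha beta * y *
    kilbas_saigo alpha (1 + beta / alpha) (1 + 2 * beta / alpha) (- y)) / lam k.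
  rewrite /sigmaK -/lg -/y -[in RHS](sqr_sqrtr (ltW lamk0)) /y; field.
  by rewrite gt_eqF.
rewrite kilbas_saigoE// ler_wpM2r ?invr_ge0 ?(ltW lamk0)//.
have := lim_gamma_step_series_le alpha01 beta0 y0y.
have : y0 * step 1 <= 2^-1.
  rewrite -ler_pdivlMr// -invfM ge_min; apply/orP; right.
  by rewrite mulrC.
set L := limn _; move=> h1 h2.
rewrite lerBrDr -lerBrDl; apply: le_trans h2 _.
have : 0 <= y0 * step 0 * (2^-1 - y0 * step 1).
  by rewrite mulr_ge0 ?subr_ge0// mulr_ge0// ltW.
lra.
Qed.

End SigmaLowerBound.

(** * Spectral expansions in L^2 *)

Section AlmostEverywhereIntegral.
Context d (T : measurableType d) (R : realType) (mu : {measure set T -> \bar R}).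
Import HBNNSimple.

(** The integral is a supremum over simple functions below [f], even for a non-measurable [f];
    multiplying a simple function by the indicator of the complement of [N] does not change its
    integral. *)
Lemma ge0_integral_setC_null (N : set T) (f : T -> \bar R) : measurable N ->
  mu N = 0%E -> (forall x, 0 <= f x)%E ->
  (\int[mu]_x f x = \int[mu]_x (f \_ (~` N)) x)%E.
Proof.
move=> mN N0 f0.
have f0' x : (0 <= (f \_ (~` N)) x)%E by rewrite patchE; case: ifP.
rewrite !ge0_integralTE//; apply/eqP; rewrite eq_le; apply/andP; split.
  apply: ge_ereal_sup => _ [h /= hf <-].
  apply: ereal_sup_ubound => /=; exists (proj_nnsfun h (measurableC mN)).
    move=> x /=; rewrite patchE mindicE; case: ifP => xN.
      by rewrite mulr1; exact: hf.
    by rewrite mulr0.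
  rewrite -!integralT_nnsfun; apply: ge0_ae_eq_integral => //.
  - by apply/measurable_EFinP.
  - by apply/measurable_EFinP.
  - by move=> x _; rewrite lee_fin; exact: fun_ge0.
  - by move=> x _; rewrite lee_fin; exact: fun_ge0.
  exists N; split => // x /= /not_implyP[_]; apply: contra_notP => xN.
  by rewrite mindicE mem_set// mulr1.
apply: ge_ereal_sup => _ [h /= hf <-].
apply: ereal_sup_ubound; exists h => //= x; apply: le_trans (hf x) _.
by rewrite patchE; case: ifP.
Qed.

(* No measurability is assumed: [negL A u] need not be measurable
   off Omega. *)
Lemma ae_eq_Rintegral (f g : T -> R) : {ae mu, forall x, f x = g x} ->
  \int[mu]_x f x = \int[mu]_x g x.
Proof.
move=> [N [mN N0 fgN]]; rewrite /Rintegral integralE [in RHS]integralE.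
have fg : {in ~` N, f =1 g}.
  by move=> x /set_mem xN; apply: contrapT => fgx; apply/xN/fgN.
congr (fine (_ - _)%E); rewrite (ge0_integral_setC_null mN)// [RHS](ge0_integral_setC_null mN)//.
  apply: eq_integral => x _; rewrite !patchE; case: ifP => // /fg.
  by rewrite unlock/= => ->.
apply: eq_integral => x _; rewrite !patchE; case: ifP => // /fg.
by rewrite unlock/= => ->.
Qed.

End AlmostEverywhereIntegral.

Section SquareIntegrable.
Variables (R : realType) (n : nat) (Omega : set 'rV[R]_n) (oO : open Omega).
Local Notation mu := (domain_measure oO).
Local Notation L2 := (L2 oO).
Implicit Types (u v w : L2) (a : R).

Lemma integrable_mulL2 u v : mu.-integrable setT (EFin \o (fun x => u x * v x)).
Proof. by apply/Lfun1_integrable/Lfun2_mul_Lfun1; exact: LfunP. Qed.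

Lemma L2dotC u v : L2dot u v = L2dot v u.
Proof. by apply: eq_Rintegral => x _; rewrite mulrC. Qed.

Lemma L2dotDl u v w : L2dot (u + v) w = L2dot u w + L2dot v w.
Proof.
rewrite /L2dot -RintegralD//; try exact: integrable_mulL2.
by apply: eq_Rintegral => x _; rewrite -mulrDl.
Qed.

Lemma L2dotZl a u v : L2dot (a *: u) v = a * L2dot u v.
Proof.
rewrite /L2dot -RintegralZl//; last exact: integrable_mulL2.
by apply: eq_Rintegral => x _; rewrite mulrA.
Qed.

Lemma L2dotZr a u v : L2dot v (a *: u) = a * L2dot v u.
Proof. by rewrite L2dotC L2dotZl (L2dotC v). Qed.

Lemma L2dotNl u v : L2dot (- u) v = - L2dot u v.
Proof. by rewrite -scaleN1r L2dotZl mulN1r. Qed.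

Lemma L2dotBl u v w : L2dot (u - v) w = L2dot u w - L2dot v w.
Proof. by rewrite L2dotDl L2dotNl. Qed.

Lemma L2dotBr u v w : L2dot w (u - v) = L2dot w u - L2dot w v.
Proof. by rewrite L2dotC L2dotBl !(L2dotC w). Qed.

Lemma L2dot_suml m (F : 'I_m -> L2) v :
  L2dot (\sum_i F i) v = \sum_i L2dot (F i) v.
Proof.
apply: (big_morph (fun u => L2dot u v)) => [u w|]; first exact: L2dotDl.
by rewrite -(scale0r 0) L2dotZl mul0r.
Qed.

Lemma L2norm_ge0 u : 0 <= L2norm u.
Proof. by rewrite fine_ge0// Lnorm_ge0. Qed.

Lemma sqr_L2norm u : L2norm u ^+ 2 = L2dot u u.
Proof.
apply: EFin_inj; rewrite -(@powR_mulrn _ _ 2) ?L2norm_ge0// -poweR_EFin.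
rewrite /L2norm finite_norm_fine powR_Lnorm//.
rewrite /L2dot /Rintegral fineK; last by apply: integrable_fin_num => //; exact: integrable_mulL2.
by apply: eq_integral => x _ /=; rewrite powR_mulrn// real_normK ?num_real// expr2.
Qed.

Lemma L2norm_eq u v : L2dot u u = L2dot v v -> L2norm u = L2norm v.
Proof.
by rewrite -!sqr_L2norm => /eqP; rewrite eqrXn2 ?L2norm_ge0// => /eqP.
Qed.

Lemma L2normN u : L2norm (- u) = L2norm u.
Proof. by apply: L2norm_eq; rewrite L2dotNl L2dotC L2dotNl opprK. Qed.

Lemma ler_L2normD u v : L2norm (u + v) <= L2norm u + L2norm v.
Proof. exact: ler_LnormD. Qed.

Lemma cauchy_schwarz u v : `|L2dot u v| <= L2norm u * L2norm v.
Proof.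
rewrite -(@ler_pXn2r _ 2) ?nnegrE ?mulr_ge0 ?L2norm_ge0//.
rewrite exprMn !sqr_L2norm real_normK ?num_real//.
have quad t : 0 <= L2dot u u - 2 * t * L2dot u v + t ^+ 2 * L2dot v v.
  have := sqr_ge0 (L2norm (u - t *: v)); rewrite sqr_L2norm.
  rewrite L2dotBl !L2dotBr !L2dotZl !L2dotZr (L2dotC v u).
  lra.
have u0 : 0 <= L2dot u u by rewrite -sqr_L2norm sqr_ge0.
have : 0 <= L2dot v v by rewrite -sqr_L2norm sqr_ge0.
move: (L2dot u u) (L2dot v v) (L2dot u v) quad u0 => A B C quad A0.
(* If [B = 0], the quadratic is affine in [t], and a nonzero slope would let it take the value -1.
   Otherwise it is evaluated at its minimum [C / B]. *)
rewrite le0r => /predU1P[B0|B0].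
  have [->|C0] := eqVneq C 0; first by rewrite expr0n/= B0 mulr0.
  have := quad ((A + 1) / (2 * C)); rewrite B0 mulr0 addr0.
  rewrite (_ : _ - _ = -1); last by field.
  by rewrite lerNr oppr0 ler10.
have := quad (C / B).
rewrite (_ : _ + _ = (A * B - C ^+ 2) / B); last by field; rewrite gt_eqF.
by rewrite pmulr_lge0 ?invr_gt0// subr_ge0.
Qed.

Lemma L2dot_ae u v w : L2eq u v -> L2dot u w = L2dot v w.
Proof.
by move=> uv; apply: ae_eq_Rintegral; apply: filterS uv => x ->.
Qed.

Variable phi : nat -> L2.

(** Norm convergence implies weak convergence, by Cauchy-Schwarz. *)
Lemma spectral_sum_cvg s u w v : is_spectral_sum phi s u w ->
  (fun m => \sum_(k < m) s k * L2dot u (phi k) * L2dot (phi k) v) @ \oo --> L2dot w v.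
Proof.
move=> sw; have nv0 : (fun m => L2norm (\sum_(k < m) (s k * L2dot u (phi k)) *: phi k - w)
    * L2norm v) @ \oo --> (0 : R).
  by rewrite -[X in _ --> X](mul0r (L2norm v)); apply: cvgM => //; exact: cvg_cst.
apply/cvgrPdist_le => e e0; have /cvgrPdist_le/(_ e e0) := nv0.
apply: filterS => m; rewrite sub0r normrN => h.
apply: le_trans _ h; rewrite distrC [leRHS]ger0_norm ?mulr_ge0 ?L2norm_ge0//.
apply: le_trans (cauchy_schwarz _ _); rewrite L2dotBl L2dot_suml.
by under [in leRHS]eq_bigr => k _ do rewrite L2dotZl.
Qed.

Hypothesis phi1 : Defs.orthonormal phi.

Lemma sum_orthonormal m (c : nat -> R) j :
  \sum_(k < m) c k * L2dot (phi k) (phi j) = if (j < m)%N then c j else 0.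
Proof.
case: ifPn => [jm|]; last first.
  rewrite -leqNgt => mj; apply: big1 => k _.
  by rewrite phi1 ltn_eqF ?mulr0// (leq_trans (ltn_ord k)).
rewrite (bigD1 (Ordinal jm))//= phi1 eqxx mulr1 big1 ?addr0// => k; rewrite -val_eqE/= => kj.
by rewrite phi1 (negbTE kj) mulr0.
Qed.

Lemma spectral_sum_coef s u w j : is_spectral_sum phi s u w ->
  L2dot w (phi j) = s j * L2dot u (phi j).
Proof.
move=> /spectral_sum_cvg => /(_ (phi j)) h; apply: (cvg_unique _ h) => //.
apply: cvg_near_cst; near=> m.
rewrite (sum_orthonormal m (fun k => s k * L2dot u (phi k))) ifT//; near: m; exact: nbhs_infty_gt.
Unshelve. all: by end_near. Qed.

Lemma spectral_sum_basis s w v j : is_spectral_sum phi s (phi j) w ->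
  L2dot w v = s j * L2dot (phi j) v.
Proof.
move=> /spectral_sum_cvg => /(_ v) h; apply: (cvg_unique _ h) => //.
apply: cvg_near_cst; near=> m.
have jm : (j < m)%N by near: m; exact: nbhs_infty_gt.
rewrite (bigD1 (Ordinal jm))//= phi1 eqxx mulr1 big1 ?addr0// => k; rewrite -val_eqE/= => kj.
by rewrite phi1 eq_sym (negbTE kj) mulr0 mul0r.
Unshelve. all: by end_near. Qed.

(** Testing the adjoint against [phi j] involves [K] only at [phi j], where its expansion has a
    single nonzero term. Self-adjointness of [K] is thus not assumed. *)
Lemma adjoint_coef K Kstar s v j : (forall u, is_spectral_sum phi s u (K u)) ->
  is_adjoint K Kstar -> L2dot (Kstar v) (phi j) = s j * L2dot v (phi j).
Proof.
move=> Ks KK; rewrite L2dotC -KK (spectral_sum_basis _ (Ks _)).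
by rewrite (L2dotC v).
Qed.

Lemma sqr_L2norm_sum m (c : nat -> R) :
  L2norm (\sum_(k < m) c k *: phi k) ^+ 2 = \sum_(k < m) c k ^+ 2.
Proof.
rewrite sqr_L2norm L2dot_suml; apply: eq_bigr => k _.
rewrite L2dotZl L2dotC L2dot_suml.
under eq_bigr => j _ do rewrite L2dotZl.
by rewrite sum_orthonormal ltn_ord expr2.
Qed.

Lemma bessel m u : \sum_(k < m) L2dot u (phi k) ^+ 2 <= L2norm u ^+ 2.
Proof.
pose s := \sum_(k < m) L2dot u (phi k) *: phi k.
have su : L2dot s u = \sum_(k < m) L2dot u (phi k) ^+ 2.
  rewrite L2dot_suml; apply: eq_bigr => k _.
  by rewrite L2dotZl expr2 (L2dotC u).
have := sqr_ge0 (L2norm (u - s)).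
rewrite [X in 0 <= X]sqr_L2norm L2dotBl !L2dotBr (L2dotC u s) su -!sqr_L2norm.
by rewrite (sqr_L2norm_sum m (fun k => L2dot u (phi k))); lra.
Qed.

Hypothesis phi_total : forall u, is_spectral_sum phi (fun=> 1) u u.

(** Converse of Bessel's inequality: completeness makes the remainder after [m] terms vanish in the
    limit. All error estimates reduce to coefficients through it. *)
Lemma L2norm_le_coef u (B : R) : 0 <= B ->
  (forall m, \sum_(k < m) L2dot u (phi k) ^+ 2 <= B ^+ 2) -> L2norm u <= B.
Proof.
move=> B0 uB; apply: (@ler_cvg_to _ \oo _ _ (fun=> L2norm u) (fun m =>
    B + L2norm (\sum_(k < m) (1 * L2dot u (phi k)) *: phi k - u))).
- exact: cvg_cst.
- rewrite -[X in _ --> X]addr0; apply: cvgD; first exact: cvg_cst.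
  exact: phi_total.
apply: nearW => m; set s := \sum_(k < m) _.
have -> : u = s - (s - u) by rewrite opprB addrC subrK.
rewrite opprB (addrC s) subrK -{1}[u](subrK s).
rewrite (le_trans (ler_L2normD _ _))// addrC lerD//; last by rewrite -L2normN opprB.
rewrite -(@ler_pXn2r _ 2) ?nnegrE ?L2norm_ge0//.
rewrite (sqr_L2norm_sum m (fun k => 1 * L2dot u (phi k))).
by under eq_bigr => k _ do rewrite mul1r.
Qed.

End SquareIntegrable.

Section WeightedNorm.
Variables (R : realType) (n : nat) (Omega : set 'rV[R]_n) (oO : open Omega).
Variables (phi : nat -> L2 oO) (s : nat -> R).
Hypothesis s0 : forall k, 0 <= s k.

(** Finiteness matters here: [fine] sends [+oo] to 0. *)
Lemma sum_weighted_normsq_le u m : (weighted_normsq phi s u < +oo)%E ->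
  \sum_(k < m) s k * L2dot u (phi k) ^+ 2 <= Num.sqrt (fine (weighted_normsq phi s u)) ^+ 2.
Proof.
have t0 k : (0 <= (s k * `|L2dot u (phi k)| ^+ 2)%:E)%E.
  by rewrite lee_fin mulr_ge0// exprn_ge0.
have w0 : (0 <= weighted_normsq phi s u)%E by apply: nneseries_ge0 => k _ _; exact: t0.
move=> woo; rewrite sqr_sqrtr ?fine_ge0// -lee_fin fineK ?ge0_fin_numE//.
apply: le_trans (nneseries_lim_ge m _); last by move=> k _ _; exact: t0.
rewrite big_mkord -sumEFin lee_sum// => k _.
by rewrite real_normK ?num_real.
Qed.

End WeightedNorm.

(** * Independence of the first eigenvalue from the eigensystem *)

Section FirstEigenvalue.
Variables (R : realType) (n : nat) (Omega : set 'rV[R]_n.+1) (oO : open Omega).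
Variable A : operator_coefs R n.
Hypothesis symA : symmetric_negL oO A.

Lemma eigensystem_dot (phi phi' : nat -> L2 oO) lam lam' i j :
  eigensystem A phi lam -> eigensystem A phi' lam' ->
  lam i * L2dot (phi i) (phi' j) = lam' j * L2dot (phi i) (phi' j).
Proof.
move=> [_ /(_ i)[di ei] _ _ _] [_ /(_ j)[dj ej] _ _ _].
have := symA di dj.
rewrite (@ae_eq_Rintegral _ _ _ _ _ (fun x => (lam i *: phi i) x * phi' j x)); last first.
  by apply: filterS ei => x ->.
rewrite [X in _ = X -> _](@ae_eq_Rintegral _ _ _ _ _ (fun x => phi i x * (lam' j *: phi' j) x));
  last by apply: filterS ej => x ->.
by rewrite -!/(L2dot _ _) L2dotZl L2dotZr.
Qed.

(** As [phi' 0] has norm 1, it has a nonzero coefficient on some [phi k]; symmetry forces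
    [lam k = lam' 0], and [lam 0] is the smallest. *)
Lemma first_eigenvalue_le (phi phi' : nat -> L2 oO) lam lam' :
  eigensystem A phi lam -> eigensystem A phi' lam' -> lam 0%N <= lam' 0%N.
Proof.
move=> es es'; have [[phi1 phiT] _ _ lamh _] := es; have [[phi'1 _] _ _ _ _] := es'.
have [[k k0]|h] := pselect (exists k, L2dot (phi k) (phi' 0%N) != 0).
  have := eigensystem_dot k 0 es es'.
  by move/(mulIf k0) => <-; exact: lamh.
have : L2norm (phi' 0%N) <= 0.
  apply: (L2norm_le_coef phi1 phiT) => // m; rewrite expr0n/= big1// => k _.
  apply/eqP; rewrite sqrf_eq0 L2dotC; apply: contrapT => k0.
  by apply: h; exists k; exact/negP.
rewrite le_eqVlt ltNge L2norm_ge0 orbF => /eqP phi0.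
have := phi'1 0%N 0%N; rewrite eqxx -sqr_L2norm phi0 expr0n/= => /esym/eqP.
by rewrite oner_eq0.
Qed.

End FirstEigenvalue.

(** * Regularization error *)

Section FilterBounds.
Variable R : realType.
Implicit Types x y s c sigma lam tau r p q : R.

(** The left side is at most the minimum of 1 and [y / x], which any power with exponent in [0, 1]
    dominates. *)
Lemma frac_le_powR x y s : 0 < x -> 0 < y -> 0 <= s <= 1 -> y / (x + y) <= (y / x) `^ s.
Proof.
move=> x0 y0 /andP[s0 s1]; have yx0 : 0 < y / x by rewrite divr_gt0.
have [yx|xy] := leP y x.
  apply: (@le_trans _ _ (y / x)).
    by rewrite ler_wpM2l ?(ltW y0)// lef_pV2 ?posrE ?addr_gt0// lerDl ltW.
  by apply: ger1_powR => //; rewrite yx0/= ler_pdivrMr// mul1r.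
apply: (@le_trans _ _ 1).
  by rewrite ler_pdivrMr ?addr_gt0// mul1r lerDr ltW.
rewrite -[leLHS](powRr0 (y / x)) ler_powR// ler_pdivlMr// mul1r ltW//.
Qed.

Lemma ler_powR_npos x y s : 0 < y -> y <= x -> s <= 0 -> x `^ s <= y `^ s.
Proof.
move=> y0 yx s0; have x0 := lt_le_trans y0 yx.
rewrite -[s]opprK !(powRN _ (- s)) lef_pV2 ?posrE ?powR_gt0//.
by rewrite ge0_ler_powR ?nnegrE ?oppr_ge0 ?(ltW x0) ?(ltW y0).
Qed.

(** Arithmetic-geometric mean inequality for [sigma ^+ 2] and [tau]. *)
Lemma noise_filter_le sigma tau e : 0 < sigma -> 0 < tau -> 1 <= e ->
  sigma / (sigma ^+ 2 + tau * e) <= tau `^ (- 2^-1).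
Proof.
move=> s0 t0 e1; have e0 : 0 < e by rewrite (lt_le_trans _ e1).
rewrite powRN powR12_sqrt ?(ltW t0)//.
have st0 : 0 < Num.sqrt tau by rewrite sqrtr_gt0.
rewrite ler_pdivrMr ?addr_gt0 ?exprn_gt0 ?mulr_gt0// mulrC ler_pdivlMr//.
have h : tau <= tau * e by rewrite ler_peMr// ltW.
apply: le_trans (lerD (lexx _) h).
rewrite -[in leRHS](sqr_sqrtr (ltW t0)).
have := sqr_ge0 (sigma - Num.sqrt tau); have := mulr_gt0 s0 st0.
by rewrite sqrrB; lra.
Qed.

(** [frac_le_powR] with exponent [q / 2], which is where [q <= 2], the saturation of the method,
    comes from. *)
Lemma bias_filter_le c sigma lam tau e B q : 0 < c -> 0 < lam -> 0 < tau ->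
  0 < e <= B -> c / lam <= sigma -> 0 <= q <= 2 ->
  tau * e / (sigma ^+ 2 + tau * e) <= (B / c ^+ 2) `^ (q / 2) * tau `^ (q / 2) * lam `^ q.
Proof.
move=> c0 l0 t0 /andP[e0 eB] cs /andP[q0 q2].
have B0 := lt_le_trans e0 eB.
have s0 : 0 < sigma by rewrite (lt_le_trans _ cs)// divr_gt0.
have q20 : 0 <= q / 2 by rewrite divr_ge0.
apply: (le_trans (@frac_le_powR _ _ (q / 2) _ _ _)).
- by rewrite exprn_gt0.
- by rewrite mulr_gt0.
- by rewrite q20/= ler_pdivrMr// mul1r.
have -> : lam `^ q = (lam ^+ 2) `^ (q / 2).
  by rewrite -powR_mulrn ?(ltW l0)// -powRrM mulrC divfK.
have Bc0 : 0 <= B / c ^+ 2 by rewrite divr_ge0 ?exprn_ge0// ltW.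
have Bt0 : 0 <= B / c ^+ 2 * tau := mulr_ge0 Bc0 (ltW t0).
have l20 : 0 <= lam ^+ 2 by rewrite exprn_ge0// ltW.
have te0 : 0 <= tau * e / sigma ^+ 2 by rewrite divr_ge0 ?exprn_ge0 ?mulr_ge0 ?ltW.
rewrite -!powRM ?(ltW t0)// ge0_ler_powR ?nnegrE ?(mulr_ge0 Bt0 l20)//.
rewrite ler_pdivrMr ?exprn_gt0//.
rewrite (_ : B / c ^+ 2 * tau * lam ^+ 2 * sigma ^+ 2 = tau * B * (sigma * lam / c) ^+ 2);
  last by field; rewrite gt_eqF.
rewrite -[leLHS]mulr1 ler_pM ?mulr_ge0 ?(ltW t0) ?(ltW e0)// ?ler_wpM2l ?(ltW t0)//.
by rewrite exprn_ege1// ler_pdivlMr// mul1r -ler_pdivrMr.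
Qed.

Lemma exp_noise_filter_le c sigma lam tau r : 0 < c -> 0 < lam -> 0 < tau -> 0 < r ->
  c / lam <= sigma ->
  sigma / (sigma ^+ 2 + tau * expR (lam `^ r)) <=
    c^-1 `^ (r / (2 + r)) * tau `^ (- (2 + r)^-1).
Proof.
move=> c0 l0 t0 r0 cs; set e := expR _; have e0 : 0 < e by rewrite expR_gt0.
have s0 : 0 < sigma by rewrite (lt_le_trans _ cs)// divr_gt0.
have r2 : 0 < 2 + r by rewrite addr_gt0.
(* This exponent solves [1 - 2 * th = r * th]: the leftover power of [sigma^-1] is then at most a
   constant times [(lam^r)^th], which [e^(- th)] compensates. *)
pose th := (2 + r)^-1; have th0 : 0 < th by rewrite invr_gt0.
have thr : 1 - 2 * th = r * th by rewrite /th; field; rewrite gt_eqF.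
have te0 : 0 < tau * e by rewrite mulr_gt0.
rewrite -/th.
have -> : sigma / (sigma ^+ 2 + tau * e) =
    sigma^-1 * (sigma ^+ 2 / (tau * e + sigma ^+ 2)).
  by field; rewrite !gt_eqF// addr_gt0// exprn_gt0.
apply: (@le_trans _ _ (sigma^-1 * (sigma ^+ 2 / (tau * e)) `^ th)).
  rewrite ler_wpM2l ?invr_ge0 ?(ltW s0)// frac_le_powR ?exprn_gt0//.
  by rewrite (ltW th0)/= invf_le1//; lra.
have -> : sigma^-1 * (sigma ^+ 2 / (tau * e)) `^ th =
    sigma^-1 `^ (r * th) * (tau `^ (- th) * e `^ (- th)).
  have -> : (sigma ^+ 2 / (tau * e)) `^ th = sigma `^ (2 * th) * (tau `^ (- th) * e `^ (- th)).
    rewrite powRM ?invr_ge0 ?exprn_ge0 ?(ltW te0) ?(ltW s0)//.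
    rewrite -(powR_mulrn 2 (ltW s0)) -powRrM -(powR_inv1 (ltW te0)) -powRrM mulN1r.
    by rewrite powRM ?(ltW t0) ?(ltW e0).
  rewrite [LHS]mulrA; congr (_ * _).
  rewrite -(powR_inv1 (ltW s0)) -powRrM -powRD ?(gt_eqF s0) ?implybT//.
  by congr (_ `^ _); rewrite -thr; ring.
have sl : sigma^-1 <= lam / c by rewrite -[leRHS]invf_div lef_pV2 ?posrE ?divr_gt0.
rewrite [leRHS]mulrC mulrCA ler_wpM2l ?powR_ge0// powRN ler_pdivrMr ?powR_gt0//.
have rth : 0 <= r * th by rewrite mulr_ge0 ?ltW.
apply: (@le_trans _ _ ((lam / c) `^ (r * th))).
  have lc0 : 0 <= lam / c by rewrite divr_ge0 ?(ltW l0) ?(ltW c0).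
  by rewrite ge0_ler_powR ?nnegrE ?(le_trans _ sl) ?invr_ge0 ?(ltW s0).
rewrite powRM ?invr_ge0 ?(ltW c0) ?(ltW l0)// mulrC ler_wpM2l ?powR_ge0//.
rewrite powRrM ge0_ler_powR ?nnegrE ?powR_ge0 ?(ltW th0) ?(ltW e0)//.
by rewrite (le_trans _ (expR_ge1Dx _))// lerDr.
Qed.

Lemma exp_bias_filter_le c r p : 0 < c -> 0 < r -> 1 < p ->
  exists2 K, 0 < K & forall sigma lam tau, 0 < lam -> 0 < tau -> c / lam <= sigma ->
  tau * expR (lam `^ r) / (sigma ^+ 2 + tau * expR (lam `^ r)) <=
    K * tau `^ (p + 1)^-1 * expR (lam `^ r / 2).
Proof.
move=> c0 r0 p1; have p0 : 0 < p + 1 by rewrite addr_gt0// (lt_trans _ p1).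
pose om := (p + 1)^-1; have om0 : 0 < om by rewrite invr_gt0.
have om2 : om < 2^-1 by rewrite ltf_pV2 ?posrE//; lra.
(* As [p > 1], the exponent [om] is below 1/2; the gap [k] leaves a factor [expR (k * x)] that
   absorbs the power [lam^(2 * om)]. *)
pose k := 2^-1 - om; have k0 : 0 < k by rewrite subr_gt0.
have omr : 0 <= 2 * om / r by rewrite divr_ge0 ?(ltW r0)// mulr_ge0// ltW.
have [M M0 MP] := powR_le_expR omr k0.
exists (M * (c ^- 2) `^ om).
  by rewrite mulr_gt0// powR_gt0// invr_gt0 exprn_gt0.
move=> sigma lam tau l0 t0 cs.
have s0 : 0 < sigma by rewrite (lt_le_trans _ cs)// divr_gt0.
set x := lam `^ r; have x0 : 0 <= x by rewrite powR_ge0.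
apply: (le_trans (@frac_le_powR _ _ om _ _ _)).
- by rewrite exprn_gt0.
- by rewrite mulr_gt0// expR_gt0.
- by rewrite (ltW om0)/= (le_trans (ltW om2))// invf_le1// ler1n.
have : (tau * expR x / sigma ^+ 2) `^ om <= (tau * expR x * (lam ^+ 2 * c ^- 2)) `^ om.
  rewrite ge0_ler_powR ?nnegrE ?(ltW om0)//.
  - by rewrite divr_ge0 ?exprn_ge0 ?(ltW s0)// mulr_ge0 ?expR_ge0// ltW.
  - by rewrite mulr_ge0 ?divr_ge0 ?exprn_ge0 ?(ltW l0) ?(ltW c0)// mulr_ge0 ?expR_ge0// ltW.
  rewrite ler_wpM2l ?mulr_ge0 ?expR_ge0 ?(ltW t0)// -[leRHS]invf_div.
  rewrite lef_pV2 ?posrE ?exprn_gt0 ?divr_gt0 ?exprn_gt0//.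
  by rewrite -expr_div_n ler_pXn2r ?nnegrE ?divr_ge0 ?(ltW c0) ?(ltW l0) ?(ltW s0).
move=> /le_trans; apply.
have l20 : 0 <= lam ^+ 2 by rewrite exprn_ge0// ltW.
have c20 : 0 <= c ^- 2 by rewrite invr_ge0 exprn_ge0// ltW.
have ex0 := expR_ge0 x; have tx0 := mulr_ge0 (ltW t0) ex0.
rewrite (powRM om tx0 (mulr_ge0 l20 c20)) (powRM om (ltW t0) ex0) (powRM om l20 c20).
have -> : (lam ^+ 2) `^ om = x `^ (2 * om / r).
  rewrite -(powR_mulrn 2 (ltW l0)) -(powRrM lam) /x -(powRrM lam r); congr (_ `^ _).
  by field; rewrite gt_eqF.
have -> : expR (x / 2) = expR (k * x) * expR x `^ om.
  by rewrite -expRM -expRD /k; congr expR; ring.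
rewrite -/om (_ : tau `^ om * _ * _ =
    (c ^- 2) `^ om * tau `^ om * expR x `^ om * x `^ (2 * om / r));
  last by ring.
rewrite (_ : M * _ * _ * _ = (c ^- 2) `^ om * tau `^ om * expR x `^ om * (M * expR (k * x)));
  last by ring.
by rewrite ler_wpM2l ?mulr_ge0 ?powR_ge0// MP.
Qed.

End FilterBounds.

(** * Error of the regularized solution *)

Section TikhonovError.
Variables (R : realType) (alpha beta l : R) (n : nat).
Variables (Omega : set 'rV[R]_n) (oO : open Omega).
Variables (phi : nat -> L2 oO) (lam : nat -> R) (K Kstar : L2 oO -> L2 oO).
Variables (f F g h hd : L2 oO) (delta tau r : R) (greg : L2 oO).
Hypothesis phi_basis : orthonormal_basis phi.
Hypothesis problem : noisy_trace_problem alpha beta l phi lam K Kstar f F g h hd delta.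
Hypothesis solution : is_tikhonov_solution phi lam K Kstar tau r (F - hd) greg.
Hypothesis tau_gt0 : 0 < tau.
Local Notation sigma := (sigmaK alpha beta l lam).
Local Notation e k := (expR (lam k `^ r)).

Let phi1 : Defs.orthonormal phi. Proof. by case: phi_basis. Qed.

(** Projects the normal equation and the trace identity on [phi k]; [F] occurs in both and
    cancels. *)
Lemma tikhonov_error_coef k : L2dot (greg - g) (phi k) =
  (sigma k * L2dot (h - hd) (phi k) - tau * e k * L2dot g (phi k)) /
    (sigma k ^+ 2 + tau * e k).
Proof.
have [KP KsP _ hE _] := problem; have [w wP eqn] := solution.
have Kc u : L2dot (K u) (phi k) = sigma k * L2dot u (phi k).
  exact: (spectral_sum_coef phi1 k (KP u)).
have Ksc v : L2dot (Kstar v) (phi k) = sigma k * L2dot v (phi k).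
  exact: (adjoint_coef phi1 v k KP KsP).
have := L2dot_ae (phi k) eqn.
rewrite L2dotDl L2dotZl !Ksc Kc (spectral_sum_coef phi1 k wP).
have := L2dot_ae (phi k) hE; rewrite !L2dotBl Kc.
move: (L2dot h _) (L2dot F _) (L2dot hd _) (L2dot g _) (L2dot greg _) => H F' D G U hF eq.
have D0 : sigma k ^+ 2 + tau * e k != 0.
  by rewrite gt_eqF// ltr_wpDl ?sqr_ge0// mulr_gt0 ?expR_gt0.
apply: (mulIf D0); rewrite divfK// mulrBl.
have -> : U * (sigma k ^+ 2 + tau * e k) = sigma k * (F' - D).
  by rewrite -eq; ring.
by rewrite hF; ring.
Qed.

(** Coefficientwise, the square of a difference is at most twice the sum of the squares. Bessel's
    inequality sums the noise part and the weighted norm of [g] sums the bias part. *)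
Lemma tikhonov_error_le (a b : R) (w : nat -> R) :
  0 <= a -> 0 <= b -> (forall k, 0 <= w k) -> (forall k, 0 <= sigma k) ->
  (forall k, sigma k / (sigma k ^+ 2 + tau * e k) <= a) ->
  (forall k, tau * e k / (sigma k ^+ 2 + tau * e k) <= b * w k) ->
  (weighted_normsq phi (fun k => (w k ^+ 2)%R) g < +oo)%E ->
  L2norm (greg - g) <=
    2 * (a * delta + b * Num.sqrt (fine (weighted_normsq phi (fun k => w k ^+ 2) g))).
Proof.
move=> a0 b0 w0 s0 ha hb gfin; set N := Num.sqrt _.
have N0 : 0 <= N by rewrite sqrtr_ge0.
have [_ _ _ _ noise] := problem.
have d0 : 0 <= delta by rewrite (le_trans _ noise)// L2norm_ge0.
have [_ phiT] := phi_basis.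
apply: (L2norm_le_coef phi1 phiT) => [|m].
  by rewrite mulr_ge0// addr_ge0// mulr_ge0.
have w20 k : 0 <= w k ^+ 2 by rewrite sqr_ge0.
have gN := @sum_weighted_normsq_le _ _ _ _ phi _ w20 g m gfin.
have nN : \sum_(k < m) L2dot (h - hd) (phi k) ^+ 2 <= delta ^+ 2.
  apply: le_trans (bessel phi1 m _) _; rewrite ler_pXn2r ?nnegrE ?L2norm_ge0//.
  by rewrite -L2normN opprB.
apply: (@le_trans _ _ (2 * a ^+ 2 * delta ^+ 2 + 2 * b ^+ 2 * N ^+ 2)); last first.
  have := mulr_ge0 (mulr_ge0 a0 d0) (mulr_ge0 b0 N0).
  have := sqr_ge0 (a * delta); have := sqr_ge0 (b * N).
  by rewrite !exprMn; lra.
apply: (@le_trans _ _ (2 * a ^+ 2 * (\sum_(k < m) L2dot (h - hd) (phi k) ^+ 2) +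
    2 * b ^+ 2 * (\sum_(k < m) w k ^+ 2 * L2dot g (phi k) ^+ 2))); last first.
  by apply: lerD; rewrite ler_wpM2l// mulr_ge0// sqr_ge0.
rewrite !mulr_sumr -big_split/=; apply: ler_sum => k _.
rewrite tikhonov_error_coef mulrBl.
have D0 : 0 < sigma k ^+ 2 + tau * e k.
  by rewrite ltr_wpDl ?sqr_ge0// mulr_gt0 ?expR_gt0.
move: (L2dot (h - hd) _) (L2dot g _) => x y.
rewrite mulrAC (mulrAC _ y).
have := ha k; have := hb k.
have : 0 <= sigma k / (sigma k ^+ 2 + tau * e k) by rewrite divr_ge0 ?(ltW D0).
have : 0 <= tau * e k / (sigma k ^+ 2 + tau * e k).
  by rewrite divr_ge0 ?(ltW D0)// mulr_ge0 ?expR_ge0 ?(ltW tau_gt0).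
move: (sigma k / _) (tau * e k / _) => A B B0 A0 Bb Aa.
apply: (@le_trans _ _ (2 * A ^+ 2 * x ^+ 2 + 2 * B ^+ 2 * y ^+ 2)).
  have := sqr_ge0 (A * x + B * y); rewrite sqrrD sqrrB !exprMn; lra.
apply: lerD.
  by rewrite ler_wpM2r ?sqr_ge0// ler_wpM2l// ler_pXn2r ?nnegrE.
rewrite mulrA ler_wpM2r ?sqr_ge0// -mulrA ler_wpM2l// -exprMn ler_pXn2r ?nnegrE//.
by rewrite mulr_ge0.
Qed.

End TikhonovError.

(** The bound must precede the choice of an eigensystem: it is read off any one of them, and is
    arbitrary if there is none. *)
Lemma first_eigenvalue_lower_bound (R : realType) n (Omega : set 'rV[R]_n.+1)
    (oO : open Omega) (A : operator_coefs R n) : symmetric_negL oO A ->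
  exists2 lam1 : R, 0 < lam1 & forall (phi : nat -> L2 oO) lam,
    eigensystem A phi lam -> forall k, lam1 <= lam k.
Proof.
move=> symA.
have [[[phi0 lam0] /= es0]|no] :=
    pselect (exists pl : (nat -> L2 oO) * (nat -> R), eigensystem A pl.1 pl.2).
  have [_ _ lam00 _ _] := es0; exists (lam0 0%N) => // phi lam es k.
  have [_ _ _ lamh _] := es.
  by rewrite (le_trans (first_eigenvalue_le symA es0 es))// lamh.
by exists 1 => // phi lam es; case: no; exists (phi, lam).
Qed.

Theorem theorem4 (R : realType) (alpha beta l : R) (n : nat)
    (Omega : set 'rV[R]_n.+1) (oO : open Omega) (A : operator_coefs R n)
    (alpha01 : 0 < alpha <= 1) (beta_ge0 : 0 <= beta) (l_gt0 : 0 < l)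
    (Omega_neq0 : Omega !=set0) (Omega_bounded : bounded_set Omega)
    (Omega_connected : connected Omega) (Omega_smooth : smooth_boundary Omega)
    (A_elliptic : uniformly_elliptic Omega A) (A_symmetric : symmetric_negL oO A) :
  (forall r p : R, r <= 0 -> 0 < p ->
    exists2 C : R, 0 < C &
    forall (phi : nat -> L2 oO) (lam : nat -> R), eigensystem A phi lam ->
    forall (K Kstar : L2 oO -> L2 oO) (f F g h hd : L2 oO) (delta : R),
      0 < delta ->
      noisy_trace_problem alpha beta l phi lam K Kstar f F g h hd delta ->
      in_Dpow phi lam p g ->
    forall (tau : R) (greg : L2 oO),
      is_tikhonov_solution phi lam K Kstar tau r (F - hd) greg ->
      (2 <= p -> tau = delta `^ (2 / 3) ->
        L2norm (greg - g) <= C * (1 + norm_Dpow phi lam p g) * delta `^ (2 / 3))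
      /\
      (p < 2 -> tau = delta `^ (2 / (p + 1)) ->
        L2norm (greg - g) <=
          C * (1 + norm_Dpow phi lam p g) * delta `^ (p / (p + 1))))
  /\
  (forall r p : R, 0 < r -> 1 < p ->
    exists2 C : R, 0 < C &
    forall (phi : nat -> L2 oO) (lam : nat -> R), eigensystem A phi lam ->
    forall (K Kstar : L2 oO -> L2 oO) (f F g h hd : L2 oO) (delta : R),
      0 < delta ->
      noisy_trace_problem alpha beta l phi lam K Kstar f F g h hd delta ->
      in_Dexp phi lam r g ->
    forall (tau : R) (greg : L2 oO),
      is_tikhonov_solution phi lam K Kstar tau r (F - hd) greg ->
      tau = delta `^ ((p + 1) * (2 + r) / ((2 + r) + (p + 1))) ->
      L2norm (greg - g) <=
        C * (1 + norm_exp phi lam r g) *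
          delta `^ ((2 + r) / ((2 + r) + (p + 1)))).
Proof.
(* [lam1] and [c] are fixed before any eigensystem, source or noise level is introduced, so the
   constants chosen below cannot depend on them. *)
have [lam1 lam10 lam1P] := first_eigenvalue_lower_bound A_symmetric.
have [c c0 cP] := sigmaK_ge alpha01 beta_ge0 l_gt0 lam10.
split=> r p.
(* Truncating the smoothness at 2 treats both regimes at once. *)
- move=> r0 p0; pose q := Num.min p 2.
  have q0 : 0 < q by rewrite /q lt_min p0/=.
  have qp : q <= p by rewrite /q ge_min lexx.
  have q2 : 0 <= q <= 2 by rewrite (ltW q0) /q ge_min lexx orbT.
  have q1 : 0 < q + 1 by rewrite addr_gt0.
  pose B := expR (lam1 `^ r).
  (* The bias filter produces [lam^q = lam^(q - p) * lam^p]; since [q <= p], the first factor is at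
     most [lam1^(q - p)]. *)
  pose M := (B / c ^+ 2) `^ (q / 2) * lam1 `^ (q - p).
  have M0 : 0 <= M by rewrite mulr_ge0 ?powR_ge0.
  exists (2 * (1 + M)); first by rewrite mulr_gt0// ltr_wpDr.
  move=> phi lam es K Kstar f F g h hd delta d0 pb gD tau greg sol.
  have lamk k := lam1P _ _ es k.
  have lam0 k : 0 < lam k := lt_le_trans lam10 (lamk k).
  have s0 k : 0 < sigmaK alpha beta l lam k.
    by rewrite (lt_le_trans _ (cP _ _ (lamk k)))// divr_gt0.
  have [basis _ _ _ _] := es.
  suff main : tau = delta `^ (2 / (q + 1)) -> L2norm (greg - g) <=
      2 * (1 + M) * (1 + norm_Dpow phi lam p g) * delta `^ (q / (q + 1)).
    split=> [p2|p2] tauE.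
    + have qE : q = 2 by rewrite /q; apply/min_idPr.
      have e3 : 2 + 1 = 3 :> R by ring.
      by move: main; rewrite qE e3; apply.
    + by have qE : q = p; [rewrite /q; apply/min_idPl/ltW|move: main; rewrite qE; apply].
  move=> tauE; have t0 : 0 < tau by rewrite tauE powR_gt0.
  (* The choice of [tau] balances noise and bias: [E1] and [E2] give the same power of [delta]. *)
  have E1 : tau `^ (- 2^-1) * delta = delta `^ (q / (q + 1)).
    rewrite tauE -powRrM -[X in _ * X](powRr1 (ltW d0)) -powRD ?(gt_eqF d0) ?implybT//.
    by congr (_ `^ _); field; rewrite gt_eqF.
  have E2 : tau `^ (q / 2) = delta `^ (q / (q + 1)).
    by rewrite tauE -powRrM; congr (_ `^ _); field; rewrite gt_eqF.
  have wE : (fun k => lam k `^ (2 * p)) = (fun k => (lam k `^ p) ^+ 2).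
    by apply/funext => k; rewrite -[RHS]powR_mulrn ?powR_ge0// -powRrM mulrC.
  have := @tikhonov_error_le _ _ _ _ _ _ _ _ _ _ _ _ _ _ _ _ _ _ _ _ basis pb sol t0
    (tau `^ (- 2^-1)) (M * tau `^ (q / 2)) (fun k => lam k `^ p).
  rewrite -wE -/(normsq_Dpow phi lam p g) -/(norm_Dpow phi lam p g).
  rewrite E1 E2; set D := delta `^ _; set N := norm_Dpow _ _ _ _ => err.
  have D0 : 0 <= D by rewrite powR_ge0.
  have N0 : 0 <= N by rewrite sqrtr_ge0.
  apply: le_trans (err _ _ _ _ _ _ gD) _.
  + exact: powR_ge0.
  + by rewrite mulr_ge0.
  + by move=> k; rewrite powR_ge0.
  + by move=> k; rewrite ltW.
  + move=> k; apply: noise_filter_le => //.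
    by rewrite -[leLHS]expR0 ler_expR powR_ge0.
  + move=> k; have eB : 0 < expR (lam k `^ r) <= B.
      by rewrite expR_gt0 ler_expR ler_powR_npos.
    apply: le_trans (bias_filter_le c0 (lam0 k) t0 eB (cP _ _ (lamk k)) q2) _.
    rewrite E2 -/D /M (mulrAC _ _ D) -!mulrA ler_wpM2l ?powR_ge0// ler_wpM2l//.
    rewrite -{1}(subrK p q) (@powRD _ (lam k) (q - p) p) ?(gt_eqF (lam0 k)) ?implybT//.
    rewrite ler_wpM2r ?powR_ge0//.
    by rewrite ler_powR_npos// subr_le0.
  + have := mulr_ge0 D0 N0; have := mulr_ge0 M0 D0; nra.
- move=> r0 p1.
  have p10 : 0 < p + 1 by rewrite addr_gt0// (lt_trans _ p1).
  have r20 : 0 < 2 + r by rewrite addr_gt0.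
  have [M M0 MP] := exp_bias_filter_le c0 r0 p1.
  pose a := c^-1 `^ (r / (2 + r)).
  have a0 : 0 <= a by rewrite powR_ge0.
  exists (2 * (a + M)); first by rewrite mulr_gt0// ltr_wpDl.
  move=> phi lam es K Kstar f F g h hd delta d0 pb gD tau greg sol tauE.
  have lamk k := lam1P _ _ es k.
  have lam0 k : 0 < lam k := lt_le_trans lam10 (lamk k).
  have s0 k : 0 < sigmaK alpha beta l lam k.
    by rewrite (lt_le_trans _ (cP _ _ (lamk k)))// divr_gt0.
  have [basis _ _ _ _] := es.
  have t0 : 0 < tau by rewrite tauE powR_gt0.
  have rp0 : 0 < 2 + r + (p + 1) by rewrite addr_gt0.
  (* The same balance, now between [tau^(- 1 / (2 + r)) * delta] and [tau^(1 / (p + 1))]. *)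
  have E1 : tau `^ (- (2 + r)^-1) * delta = delta `^ ((2 + r) / (2 + r + (p + 1))).
    rewrite tauE -powRrM -[X in _ * X](powRr1 (ltW d0)) -powRD ?(gt_eqF d0) ?implybT//.
    by congr (_ `^ _); field; rewrite !gt_eqF.
  have E2 : tau `^ (p + 1)^-1 = delta `^ ((2 + r) / (2 + r + (p + 1))).
    by rewrite tauE -powRrM; congr (_ `^ _); field; rewrite !gt_eqF.
  have wE : (fun k => expR (lam k `^ r)) = (fun k => expR (lam k `^ r / 2) ^+ 2).
    by apply/funext => k; rewrite expr2 -expRD -splitr.
  have := @tikhonov_error_le _ _ _ _ _ _ _ _ _ _ _ _ _ _ _ _ _ _ _ _ basis pb sol t0
    (a * tau `^ (- (2 + r)^-1)) (M * tau `^ (p + 1)^-1) (fun k => expR (lam k `^ r / 2)).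
  rewrite -wE -/(normsq_exp phi lam r g) -/(norm_exp phi lam r g).
  rewrite -mulrA E1 E2; set D := delta `^ _; set N := norm_exp _ _ _ _ => err.
  have D0 : 0 <= D by rewrite powR_ge0.
  have N0 : 0 <= N by rewrite sqrtr_ge0.
  apply: le_trans (err _ _ _ _ _ _ gD) _.
  + by rewrite mulr_ge0 ?powR_ge0.
  + by rewrite mulr_ge0// ltW.
  + by move=> k; rewrite expR_ge0.
  + by move=> k; rewrite ltW.
  + by move=> k; apply: exp_noise_filter_le => //; exact: cP.
  + by move=> k; rewrite /D -E2; apply: MP => //; exact: cP.
  + have := mulr_ge0 a0 (mulr_ge0 D0 N0); have := mulr_ge0 (ltW M0) D0; nra.
Qed.
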